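(* For every integer $n\ge 1$ the 2-typical de Rham-Witt complex $W_\bullet\Omega^*_{\mathbb Z_{(2)}}$ of the ring $\mathbb Z_{(2)}$ has the following structure, where $V^i(1)\in W_n\Omega^0_{\mathbb Z_{(2)}}$ denotes $V^i([1]_{n-i})$. (i) As abelian groups, $$W_n\Omega^0_{\mathbb Z_{(2)}}=\bigoplus_{i=0}^{n-1}\mathbb Z_{(2)}\cdot V^i(1),\qquad W_n\Omega^1_{\mathbb Z_{(2)}}=\bigoplus_{i=1}^{n-1}\mathbb Z/2^i\mathbb Z\cdot dV^i(1),\qquad W_n\Omega^i_{\mathbb Z_{(2)}}=0\ \text{ for } i\ge 2 .$$ (ii) The product and operators are given by: $V^i(1)V^j(1)=2^iV^j(1)$ if $i\le j$; $$V^i(1)\cdot dV^j(1)=\begin{cases}2^i\,dV^j(1)+\sum_{s=j+1}^{n-1}2^{s-1}dV^s(1), & 1\le i<j,\\ \sum_{s=i+1}^{n-1}2^{s-1}dV^s(1), & 1\le j\le i;\end{cases}$$ $V(V^i(1))=V^{i+1}(1)$ and $V(dV^i(1))=2dV^{i+1}(1)$ (from level $n$ to level $n+1$); for $i\ge 1$, $F(V^i(1))=2V^{i-1}(1)$ and $F(dV^i(1))=dV^{i-1}(1)+\sum_{s=i}^{n-2}2^{s-1}dV^s(1)$ (from level $n$ to level $n-1$); $d(V^i(1))=dV^i(1)$ for $i\ge1$ and $d(1)=0$; $\iota(V^i(1))=\sum_{s=i+1}^{n-1}2^{s-1}dV^s(1)$; and $R$ from level $n$ to level $n-1$ fixes $V^i(1)$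 and $dV^i(1)$ for $i\le n-2$ and kills $V^{n-1}(1)$ and $dV^{n-1}(1)$.
   Context: All rings are commutative and unital; graded rings are graded-commutative, i.e. $xy=(-1)^{|x||y|}yx$. For a ring $A$, $W_n(A)$ is the ring of 2-typical Witt vectors of length $n$ ($W_n(A)=0$ for $n\le 0$), with restriction $R:W_n(A)\to W_{n-1}(A)$, Frobenius $F:W_n(A)\to W_{n-1}(A)$, Verschiebung $V:W_{n}(A)\to W_{n+1}(A)$, and Teichmüller map $[a]_n=(a,0,\dots,0)$. A pro-object is a sequence $\{X_n\}_{n\in\mathbb Z}$ with maps $R:X_n\to X_{n-1}$; a strict map of pro-objects is a family of maps commuting with $R$. A 2-typical Witt complex over $A$ consists of: (i) a graded-commutative pro-graded ring $\{E_n^*,R:E_n^*\to E_{n-1}^*\}_{n\in\mathbb Z}$ with $E_n^*=0$ for $n\le0$; (ii) a strict map of pro-rings $\lambda:W_\bullet(A)\to E^0_\bullet$; (iii) a strict map of pro-graded rings $F:E^*_\bullet\to E^*_{\bullet-1}$ with $\lambda F=F\lambda$; (iv) a strict map of pro-graded abelian groups $V:E^*_\bullet\to E^*_{\bullet+1}$ with $V(x)y=V(xF(y))$, $\lambda V=V\lambda$ and $FV=2$; (v) a strict map of pro-graded abelian groups $d:E^*_\bullet\to E^{*+1}_\bullet$ with $d(xy)=d(x)y+(-1)^{|x|}x\,d(y)$. Let $\iota:E_n^*\to E_n^{*+1}$ be multiplication by $\frac{d\lambda[-1]_n}{\lambda[-1]_n}$. One requires $FdV=d+\iota$, $dd=d\iota=\iota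 d$, and $Fd\lambda([a]_n)=\lambda([a]_{n-1})\,d\lambda([a]_{n-1})$ for all $a\in A$. A morphism of Witt complexes is a map of pro-graded rings commuting with $\lambda,d,F,V$. The category of 2-typical Witt complexes over $A$ has an initial object, the 2-typical de Rham-Witt complex $W_\bullet\Omega^*_A$ of $A$. The map $\lambda$ is suppressed from the notation. *)

(* Defs.v *)
From HB Require Import structures.
From mathcomp Require Import all_boot all_order all_algebra.
From mathcomp Require Import ring.

Set Implicit Arguments.
Unset Strict Implicit.
Unset Printing Implicit Defensive.

Import GRing.Theory.

Local Open Scope ring_scope.

(* W_n(A), the 2-typical Witt vectors of length n, as n-tuples of Witt
   components; witt A 0 is the zero ring. *)
Definition witt (A : Type) (n : nat) : Type := n.-tuple A.

Definition wcons (A : Type) n (a : A) (x : witt A n) : witt A n.+1 :=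
  cons_tuple a x.
Definition whead (A : Type) n (x : witt A n.+1) : A := thead x.
Definition wtail (A : Type) n (x : witt A n.+1) : witt A n :=
  [tuple of behead x].
Definition wmap (A B : Type) (f : A -> B) n (x : witt A n) : witt B n :=
  map_tuple f x.

Lemma whead_cons (A : Type) n (a : A) (x : witt A n) : whead (wcons a x) = a.
Proof. by []. Qed.

Lemma wtail_cons (A : Type) n (a : A) (x : witt A n) : wtail (wcons a x) = x.
Proof. exact: val_inj. Qed.

Lemma wcons_eta (A : Type) n (x : witt A n.+1) : wcons (whead x) (wtail x) = x.
Proof. by apply: val_inj; case: x => -[|a s]. Qed.

Lemma witt0E (A : Type) (x y : witt A 0) : x = y.
Proof. by rewrite (tuple0 x) (tuple0 y). Qed.

Lemma wmap_cons (A B : Type) (f : A -> B) n a (x : witt A n) :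
  wmap f (wcons a x) = wcons (f a) (wmap f x).
Proof. exact: val_inj. Qed.

Section WittOps.
Variable A : comPzRingType.

Definition wzero n : witt A n := nseq_tuple n 0.

Definition teich n (a : A) : witt A n :=
  match n with 0%N => [tuple] | m.+1 => wcons a (wzero m) end.

Definition ghost n (k : nat) (x : witt A n) : A :=
  \sum_(i < n | (i <= k)%N) tnth x i ^+ (2 ^ (k - i)) *+ 2 ^ i.

(* The ring operations are given by structural recursion on the length, through
   x = [x_0] + V(x'), where x' is the tail of x.  The recursion also produces the
   carry C_n(a,b) in W_n(A), characterized by [a] + [b] = [a + b] + V(C_n(a,b))
   in W_{n+1}(A).  One has [a] V(y') = V([a^2] y') and V(x') V(y') = 2 V(x' y');
   the carry satisfies
     C_{n+1}(a,b) = - [a b] + V([(a + b)^2] C_n(a,b) + C_n(a,b)^2),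
   as one sees by comparing F and the square of [a] + [b] = [a + b] + V(C).
   These formulas hold in the Witt vectors because of the ghost equations
   wadd_ghost, wopp_ghost and wmul_ghost and of the functoriality lemmas
   wmap_add, wmap_opp and wmap_mul below, which determine the operations. *)
Record witt_ops n := WittOps {
  op_add : witt A n -> witt A n -> witt A n;
  op_opp : witt A n -> witt A n;
  op_mul : witt A n -> witt A n -> witt A n;
  op_cross : A -> A -> witt A n }.

Fixpoint wops n : witt_ops n :=
  match n with
  | 0%N => WittOps (fun _ _ => [tuple]) (fun _ => [tuple])
             (fun _ _ => [tuple]) (fun _ _ => [tuple])
  | m.+1 =>
    let add := op_add (wops m) in
    let opp := op_opp (wops m) in
    let mul := op_mul (wops m) in
    let cross := op_cross (wops m) in
    let add' x y := wcons (whead x + whead y)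
      (add (add (wtail x) (wtail y)) (cross (whead x) (whead y))) in
    let opp' x := wcons (- whead x)
      (opp (add (wtail x) (cross (whead x) (- whead x)))) in
    let mul' x y :=
      let xy := mul (wtail x) (wtail y) in
      wcons (whead x * whead y)
        (add (add (mul (teich m (whead x ^+ 2)) (wtail y))
                  (mul (teich m (whead y ^+ 2)) (wtail x)))
             (add xy xy)) in
    let cross' a b :=
      let c := cross a b in
      add' (opp' (teich m.+1 (a * b)))
           (wcons 0 (add (mul (teich m ((a + b) ^+ 2)) c) (mul c c))) in
    WittOps add' opp' mul' cross'
  end.

Definition wadd n := op_add (wops n).
Definition wopp n := op_opp (wops n).
Definition wmul n := op_mul (wops n).
Definition wcross n := op_cross (wops n).

Lemma waddS n (x y : witt A n.+1) : wadd x y = wcons (whead x + whead y)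
  (wadd (wadd (wtail x) (wtail y)) (wcross n (whead x) (whead y))).
Proof. by []. Qed.

Lemma woppS n (x : witt A n.+1) : wopp x = wcons (- whead x)
  (wopp (wadd (wtail x) (wcross n (whead x) (- whead x)))).
Proof. by []. Qed.

Lemma wmulS n (x y : witt A n.+1) : wmul x y = wcons (whead x * whead y)
  (wadd (wadd (wmul (teich n (whead x ^+ 2)) (wtail y))
              (wmul (teich n (whead y ^+ 2)) (wtail x)))
        (wadd (wmul (wtail x) (wtail y)) (wmul (wtail x) (wtail y)))).
Proof. by []. Qed.

Lemma wcrossS n a b : wcross n.+1 a b =
  wadd (wopp (teich n.+1 (a * b)))
    (wcons 0 (wadd (wmul (teich n ((a + b) ^+ 2)) (wcross n a b))
                   (wmul (wcross n a b) (wcross n a b)))).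
Proof. by []. Qed.

Lemma ghost_cons0 n a (x : witt A n) : ghost 0 (wcons a x) = a.
Proof.
by rewrite /ghost big_mkcond big_ord_recl /= big1 ?addr0 ?mulr1n //= ?expr1.
Qed.

Lemma ghost_consS n k a (x : witt A n) :
  ghost k.+1 (wcons a x) = a ^+ (2 ^ k.+1) + ghost k x *+ 2.
Proof.
rewrite /ghost big_mkcond big_ord_recl /= subn0 mulr1n.
congr (_ + _); rewrite -big_mkcond /= -sumrMnl.
apply: eq_big => [i|i lik]; first by rewrite /bump add1n ltnS.
rewrite /bump add1n subSS -mulrnA expnSr; congr (_ ^+ _ *+ _).
by rewrite !(tnth_nth 0).
Qed.

Lemma ghost_zero n k : ghost k (wzero n) = 0.
Proof.
rewrite /ghost big1 // => i _.
by rewrite (tnth_nth 0) nth_nseq ltn_ord expr0n expn_eq0 mul0rn.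
Qed.

Lemma ghost_teich n k a : (k < n)%N -> ghost k (teich n a) = a ^+ (2 ^ k).
Proof.
case: n k => [|n] [|k] //= _; first by rewrite ghost_cons0 expr1.
by rewrite ghost_consS ghost_zero mul0rn addr0.
Qed.

Lemma ghost_ops n :
  [/\ forall k (x y : witt A n), (k < n)%N -> ghost k (wadd x y) = ghost k x + ghost k y,
      forall k (x : witt A n), (k < n)%N -> ghost k (wopp x) = - ghost k x,
      forall k (x y : witt A n), (k < n)%N -> ghost k (wmul x y) = ghost k x * ghost k y
    & forall k a b, (k < n)%N -> ghost k (wcross n a b) *+ 2 =
        a ^+ (2 ^ k.+1) + b ^+ (2 ^ k.+1) - (a + b) ^+ (2 ^ k.+1) :> A].
Proof.
elim: n => [|n [IHa IHo IHm IHc]]; first by split.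
have add' k (x y : witt A n.+1) :
  (k < n.+1)%N -> ghost k (wadd x y) = ghost k x + ghost k y.
  rewrite -[in RHS](wcons_eta x) -[in RHS](wcons_eta y) waddS; case: k => [|k] ltkn.
    by rewrite !ghost_cons0.
  by rewrite !ghost_consS !IHa // !mulrnDl IHc //; ring.
have opp' k (x : witt A n.+1) : (k < n.+1)%N -> ghost k (wopp x) = - ghost k x.
  rewrite -[in RHS](wcons_eta x) woppS; case: k => [|k] ltkn.
    by rewrite !ghost_cons0.
  rewrite !ghost_consS IHo // IHa // mulNrn mulrnDl IHc // subrr.
  rewrite expr0n expn_eq0 /= expnS exprM sqrrN -exprM; ring.
have mul' k (x y : witt A n.+1) :
  (k < n.+1)%N -> ghost k (wmul x y) = ghost k x * ghost k y.
  rewrite -[in RHS](wcons_eta x) -[in RHS](wcons_eta y) wmulS; case: k => [|k] ltkn.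
    by rewrite !ghost_cons0.
  rewrite !ghost_consS !IHa // !IHm // !ghost_teich // exprMn -!exprM -!expnS.
  ring.
split=> // k a b ltkn; rewrite wcrossS add' // opp' // ghost_teich //.
case: k ltkn => [|k] ltkn; first by rewrite ghost_cons0; ring.
rewrite ghost_consS IHa // !IHm // ghost_teich // expr0n expn_eq0 /= add0r.
rewrite -exprM -expnS; set c := ghost _ _.
have Ec : c *+ 2 = a ^+ (2 ^ k.+1) + b ^+ (2 ^ k.+1) - (a + b) ^+ (2 ^ k.+1).
  by rewrite /c IHc.
rewrite [(2 ^ k.+2)%N]expnSr !exprM exprMn.
move: Ec; move: (a ^+ _) (b ^+ _) ((a + b) ^+ _) => P Q S Ec.
rewrite mulrnDl.
have -> : (S * c + c * c) *+ 2 *+ 2 = (c *+ 2) * (S *+ 2) + (c *+ 2) ^+ 2.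
  ring.
by rewrite Ec; ring.
Qed.

Lemma wadd_ghost n k (x y : witt A n) :
  (k < n)%N -> ghost k (wadd x y) = ghost k x + ghost k y.
Proof. by have [H _ _ _] := ghost_ops n; apply: H. Qed.

Lemma wopp_ghost n k (x : witt A n) :
  (k < n)%N -> ghost k (wopp x) = - ghost k x.
Proof. by have [_ H _ _] := ghost_ops n; apply: H. Qed.

Lemma wmul_ghost n k (x y : witt A n) :
  (k < n)%N -> ghost k (wmul x y) = ghost k x * ghost k y.
Proof. by have [_ _ H _] := ghost_ops n; apply: H. Qed.

End WittOps.

Section WittMap.
Variables (A B : comPzRingType) (f : {rmorphism A -> B}).

Lemma wmap_zero n : wmap f (wzero A n) = wzero B n.
Proof. by apply: val_inj; rewrite /= map_nseq rmorph0. Qed.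

Lemma wmap_teich n a : wmap f (teich n a) = teich n (f a).
Proof.
by case: n => [|n]; rewrite ?wmap_cons ?wmap_zero //; apply: witt0E.
Qed.

Lemma whead_map n (x : witt A n.+1) : whead (wmap f x) = f (whead x).
Proof. by rewrite -{1}(wcons_eta x) wmap_cons whead_cons. Qed.

Lemma wtail_map n (x : witt A n.+1) : wtail (wmap f x) = wmap f (wtail x).
Proof. by rewrite -{1}(wcons_eta x) wmap_cons wtail_cons. Qed.

Lemma wmap_ops n :
  [/\ forall x y : witt A n, wmap f (wadd x y) = wadd (wmap f x) (wmap f y),
      forall x : witt A n, wmap f (wopp x) = wopp (wmap f x),
      forall x y : witt A n, wmap f (wmul x y) = wmul (wmap f x) (wmap f y)
    & forall a b, wmap f (wcross n a b) = wcross n (f a) (f b)].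
Proof.
elim: n => [|n [IHa IHo IHm IHc]]; first by split=> *; apply: witt0E.
have add' (x y : witt A n.+1) : wmap f (wadd x y) = wadd (wmap f x) (wmap f y).
  by rewrite !waddS wmap_cons !IHa IHc !whead_map !wtail_map rmorphD.
have opp' (x : witt A n.+1) : wmap f (wopp x) = wopp (wmap f x).
  by rewrite !woppS wmap_cons IHo IHa IHc !whead_map !wtail_map rmorphN.
have mul' (x y : witt A n.+1) : wmap f (wmul x y) = wmul (wmap f x) (wmap f y).
  rewrite !wmulS wmap_cons !IHa !IHm !wmap_teich !whead_map !wtail_map.
  by rewrite rmorphM !rmorphXn.
split=> // a b; rewrite !wcrossS add' opp' wmap_teich wmap_cons.
rewrite !IHa !IHm !wmap_teich !IHc.
by rewrite rmorphM rmorphXn rmorphD rmorph0.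
Qed.

Lemma wmap_add n (x y : witt A n) :
  wmap f (wadd x y) = wadd (wmap f x) (wmap f y).
Proof. by have [H _ _ _] := wmap_ops n. Qed.

Lemma wmap_opp n (x : witt A n) : wmap f (wopp x) = wopp (wmap f x).
Proof. by have [_ H _ _] := wmap_ops n. Qed.

Lemma wmap_mul n (x y : witt A n) :
  wmap f (wmul x y) = wmul (wmap f x) (wmap f y).
Proof. by have [_ _ H _] := wmap_ops n. Qed.

End WittMap.

(* Transfer from rings without 2-torsion, where the ghost map is injective. *)
Lemma ghost_inj (A : comPzRingType) n (x y : witt A n) :
  (forall a : A, a *+ 2 = 0 -> a = 0) ->
  (forall k, (k < n)%N -> ghost k x = ghost k y) -> x = y.
Proof.
move=> tf; elim: n x y => [|n IHn] x y; first by move=> _; apply: witt0E.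
rewrite -(wcons_eta x) -(wcons_eta y) => E.
have := E 0%N isT; rewrite !ghost_cons0 => Eh; congr (wcons _ _); first by [].
apply: IHn => k ltkn; have := E k.+1 ltkn; rewrite !ghost_consS Eh => /addrI Et.
by apply/eqP; rewrite -subr_eq0; apply/eqP/tf; rewrite mulrnBl Et subrr.
Qed.

Lemma torsion_free_cover (A : comNzRingType) (s : seq A) :
  exists (B : comNzRingType) (f : {rmorphism B -> A}) (t : seq B),
    (forall b : B, b *+ 2 = 0 -> b = 0) /\ map f t = s.
Proof.
elim: s => [|a s [B [f [t [tf Et]]]]].
  exists int, intr, [::]; split=> // b /eqP.
  by rewrite -mulr_natr mulf_eq0 orbF => /eqP.
have cfu : commr_rmorph f a by move=> b; apply: mulrC.
exists {poly B}, (horner_morph cfu), ('X :: map polyC t); split.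
  move=> p Ep; apply/polyP=> i; rewrite coef0; apply: tf.
  by rewrite -coefMn Ep coef0.
rewrite /= horner_morphX -map_comp -Et; congr (_ :: _).
by apply: eq_map => b /=; rewrite horner_morphC.
Qed.

Lemma witt_transfer (A : comPzRingType) n (x y z : witt A n) :
  (1 = 0 :> A) \/ exists (B : comNzRingType) (f : {rmorphism B -> A})
    (x' y' z' : witt B n), [/\ forall b : B, b *+ 2 = 0 -> b = 0,
      wmap f x' = x, wmap f y' = y & wmap f z' = z].
Proof.
have [/eqP-> | nz] := boolP (1 == 0 :> A); [by left | right].
pose A' : comNzRingType := HB.pack A (GRing.PzSemiRing_isNonZero.Build A nz).
have [B [f [t [tf Et]]]] := @torsion_free_cover A' (x ++ y ++ z).
have sz : size t = (n + (n + n))%N.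
  by rewrite -(size_map f) Et !size_cat !size_tuple.
have sx : size (take n t) == n by rewrite size_takel // sz leq_addr.
have sy : size (take n (drop n t)) == n.
  by rewrite size_takel // size_drop sz addKn leq_addr.
have sz' : size (drop n (drop n t)) == n by rewrite !size_drop sz !addKn.
exists B, f, (Tuple sx), (Tuple sy), (Tuple sz'); split=> //; apply: val_inj.
- by rewrite /= map_take Et take_size_cat ?size_tuple.
- by rewrite /= map_take map_drop Et drop_size_cat ?take_size_cat ?size_tuple.
- by rewrite /= !map_drop Et !drop_size_cat ?size_tuple.
Qed.

Lemma witt_trivial (A : comPzRingType) n (x y : witt A n) : 1 = 0 :> A -> x = y.
Proof.
move=> t; apply: eq_from_tnth => i.
by rewrite -[LHS]mul1r -[RHS]mul1r t !mul0r.
Qed.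

Section WittRing.
Variables (A : comPzRingType) (n : nat).
Implicit Types x y z : witt A n.

Let wone : witt A n := teich n 1.

Ltac by_ghost f tf :=
  rewrite -?(wmap_zero f) -?(rmorph1 f) -?wmap_teich
          -?(wmap_add, wmap_opp, wmap_mul);
  congr (wmap _ _); apply: (ghost_inj tf) => ? ?;
  rewrite ?(wadd_ghost, wopp_ghost, wmul_ghost, ghost_zero) // ?ghost_teich //;
  rewrite ?expr1n; ring.

Fact waddA : associative (@wadd A n).
Proof.
move=> x y z; case: (witt_transfer x y z) => [/witt_trivial|]; first exact.
by case=> B [f [x' [y' [z' [tf <- <- <-]]]]]; by_ghost f tf.
Qed.
Fact waddC : commutative (@wadd A n).
Proof.
move=> x y; case: (witt_transfer x y x) => [/witt_trivial|]; first exact.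
by case=> B [f [x' [y' [z' [tf <- <- <-]]]]]; by_ghost f tf.
Qed.
Fact wadd0 : left_id (wzero A n) (@wadd A n).
Proof.
move=> x; case: (witt_transfer x x x) => [/witt_trivial|]; first exact.
by case=> B [f [x' [y' [z' [tf <- <- <-]]]]]; by_ghost f tf.
Qed.
Fact waddN : left_inverse (wzero A n) (@wopp A n) (@wadd A n).
Proof.
move=> x; case: (witt_transfer x x x) => [/witt_trivial|]; first exact.
by case=> B [f [x' [y' [z' [tf <- <- <-]]]]]; by_ghost f tf.
Qed.
Fact wmulA : associative (@wmul A n).
Proof.
move=> x y z; case: (witt_transfer x y z) => [/witt_trivial|]; first exact.
by case=> B [f [x' [y' [z' [tf <- <- <-]]]]]; by_ghost f tf.
Qed.
Fact wmulC : commutative (@wmul A n).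
Proof.
move=> x y; case: (witt_transfer x y x) => [/witt_trivial|]; first exact.
by case=> B [f [x' [y' [z' [tf <- <- <-]]]]]; by_ghost f tf.
Qed.
Fact wmul1 : left_id wone (@wmul A n).
Proof.
move=> x; rewrite /wone; case: (witt_transfer x x x) => [/witt_trivial|]; first exact.
by case=> B [f [x' [y' [z' [tf <- <- <-]]]]]; by_ghost f tf.
Qed.
Fact wmulDl : left_distributive (@wmul A n) (@wadd A n).
Proof.
move=> x y z; case: (witt_transfer x y z) => [/witt_trivial|]; first exact.
by case=> B [f [x' [y' [z' [tf <- <- <-]]]]]; by_ghost f tf.
Qed.

HB.instance Definition _ := Choice.copy (witt A n) (n.-tuple A).
HB.instance Definition _ :=
  GRing.isZmodule.Build (witt A n) waddA waddC wadd0 waddN.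
HB.instance Definition _ :=
  GRing.Zmodule_isComPzRing.Build (witt A n) wmulA wmulC wmul1 wmulDl.

End WittRing.

Section WittMaps.
Variable A : comPzRingType.

Definition wittR n (x : witt A n.+1) : witt A n :=
  [tuple tnth x (widen_ord (leqnSn n) i) | i < n].

Definition wittV n (x : witt A n) : witt A n.+1 := wcons 0 x.

(* x = [x_0] + V(x'), hence F(x) = [x_0]^2 + FV(x') = [x_0^2] + 2 x'. *)
Definition wittF n (x : witt A n.+1) : witt A n :=
  teich n (whead x ^+ 2) + wtail x *+ 2.

Lemma wittF_ghost n k (x : witt A n.+1) :
  (k < n)%N -> ghost k (wittF x) = ghost k.+1 x.
Proof.
move=> ltkn; rewrite -[in RHS](wcons_eta x) ghost_consS /wittF mulr2n.
by rewrite !wadd_ghost // ghost_teich // -exprM -expnS mulr2n.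
Qed.

Lemma teichM n (a b : A) : teich n (a * b) = teich n a * teich n b.
Proof.
case: n => [|n]; first exact: witt0E.
rewrite [RHS]wmulS /= !wtail_cons !whead_cons; congr (wcons _ _).
by rewrite [LHS](_ : _ = 0) // -[RHS]/(_ * 0 + _ * 0 + (0 * 0 + 0 * 0)) !mulr0 !addr0.
Qed.

Lemma teichN1_inv n : teich n (-1) * teich n (-1) = 1 :> witt A n.
Proof. by rewrite -teichM mulrNN mulr1. Qed.

End WittMaps.

Lemma wmap_wittF (A B : comPzRingType) (f : {rmorphism A -> B}) n
    (x : witt A n.+1) : wmap f (wittF x) = wittF (wmap f x).
Proof.
rewrite /wittF !mulr2n -![_ + _]/(wadd _ _) !wmap_add.
by rewrite wmap_teich whead_map wtail_map rmorphXn.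
Qed.

(* The localization of the integers at the prime ideal (2), as the subring of
   the rationals with odd denominator. *)
Definition Z2loc_pred : {pred rat} := fun x => odd `|denq x|%N.

Lemma Z2loc_predP (x : rat) : reflect
  (exists (a : int) (b : nat), odd b /\ x * b%:R = a%:~R) (Z2loc_pred x).
Proof.
apply: (iffP idP) => [odd_x | [a [b [odd_b Ex]]]].
  by exists (numq x), `|denq x|%N; rewrite numqE -[in RHS]absz_denq.
have : (`|denq x| %| b)%N.
  rewrite -(@Gauss_dvdr _ `|numq x|) 1?coprime_sym ?coprime_num_den //.
  have /eqP: (numq x * b%:Z)%:~R = (a * denq x)%:~R :> rat.
    by rewrite !rmorphM /= numqE -Ex -pmulrn mulrAC.
  rewrite eqr_int => /eqP/(congr1 absz); rewrite !abszM /= => ->.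
  exact: dvdn_mull.
by move/dvdnP=> [c Eb]; move: odd_b; rewrite Eb oddM => /andP[].
Qed.

Fact Z2loc_subring : subring_closed Z2loc_pred.
Proof.
split=> [|x y /Z2loc_predP[a [b [ob Ex]]] /Z2loc_predP[c [e [oe Ey]]]
         |x y /Z2loc_predP[a [b [ob Ex]]] /Z2loc_predP[c [e [oe Ey]]]].
- by apply/Z2loc_predP; exists 1, 1%N; rewrite mulr1.
- apply/Z2loc_predP; exists (a * e%:Z - c * b%:Z), (b * e)%N.
  rewrite oddM ob oe; split=> //.
  rewrite natrM rmorphB !rmorphM /= -Ex -Ey; ring.
- apply/Z2loc_predP; exists (a * c), (b * e)%N.
  by rewrite oddM ob oe natrM intrM -Ex -Ey; split=> //; ring.
Qed.
HB.instance Definition _ :=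
  GRing.isSubringClosed.Build rat Z2loc_pred Z2loc_subring.

Record Z2loc := MkZ2loc { Z2val :> rat; _ : Z2val \in Z2loc_pred }.
HB.instance Definition _ := [isSub for Z2val].
HB.instance Definition _ := [Choice of Z2loc by <:].
HB.instance Definition _ := [SubChoice_isSubComNzRing of Z2loc by <:].

(* A graded ring indexed by the natural numbers, in internal form: deg i is the
   subgroup of homogeneous elements of degree i, and E is the direct sum of the
   deg i. *)
Record graded_commutative (E : pzRingType) (deg : nat -> E -> Prop) : Prop :=
  GradedCommutative {
  gr_zero : forall i, deg i 0;
  gr_sub : forall i x y, deg i x -> deg i y -> deg i (x - y);
  gr_one : deg 0%N 1;
  gr_mul : forall i j x y, deg i x -> deg j y -> deg (i + j)%N (x * y);
  gr_comm : forall i j x y, deg i x -> deg j y ->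
    x * y = (-1) ^+ (i * j) * (y * x);
  gr_span : forall x, exists (m : nat) (c : nat -> E),
    (forall i, deg i (c i)) /\ x = \sum_(i < m) c i;
  gr_indep : forall (m : nat) (c : nat -> E), (forall i, deg i (c i)) ->
    \sum_(i < m) c i = 0 -> forall i, (i < m)%N -> c i = 0 }.

(* 2-typical Witt complexes.  Levels are indexed by the natural numbers; the
   levels n <= 0 are all zero, so that only n = 0 is kept.  The exponent * of
   E_n^* is given by wc_deg. *)
Record witt_complex (A : comPzRingType) : Type := WittComplex {
  wc_obj :> nat -> pzRingType;
  wc_deg : forall n, nat -> wc_obj n -> Prop;
  wc_R : forall n, {rmorphism wc_obj n.+1 -> wc_obj n};
  wc_lam : forall n, {rmorphism witt A n -> wc_obj n};
  wc_F : forall n, {rmorphism wc_obj n.+1 -> wc_obj n};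
  wc_V : forall n, {additive wc_obj n -> wc_obj n.+1};
  wc_d : forall n, {additive wc_obj n -> wc_obj n};
  (* [-1]_n is its own inverse (teichN1_inv), so this is multiplication by
     d lambda([-1]_n) / lambda([-1]_n). *)
  wc_iota := fun n (x : wc_obj n) =>
    wc_d n (wc_lam n (teich n (-1))) * wc_lam n (teich n (-1)) * x;

  wc_graded : forall n, graded_commutative (@wc_deg n);
  wc_obj0 : forall x : wc_obj 0%N, x = 0;
  wc_R_deg : forall n i x, wc_deg i x -> wc_deg i (wc_R n x);

  wc_lam_deg : forall n a, wc_deg 0%N (wc_lam n a);
  wc_lamR : forall n a, wc_R n (wc_lam n.+1 a) = wc_lam n (wittR a);

  wc_F_deg : forall n i x, wc_deg i x -> wc_deg i (wc_F n x);
  wc_FR : forall n x, wc_R n (wc_F n.+1 x) = wc_F n (wc_R n.+1 x);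
  wc_lamF : forall n a, wc_F n (wc_lam n.+1 a) = wc_lam n (wittF a);

  wc_V_deg : forall n i x, wc_deg i x -> wc_deg i (wc_V n x);
  wc_VR : forall n x, wc_R n.+1 (wc_V n.+1 x) = wc_V n (wc_R n x);
  wc_VM : forall n x y, wc_V n x * y = wc_V n (x * wc_F n y);
  wc_lamV : forall n a, wc_V n (wc_lam n a) = wc_lam n.+1 (wittV a);
  wc_FV : forall n x, wc_F n (wc_V n x) = x *+ 2;

  wc_d_deg : forall n i x, wc_deg i x -> wc_deg i.+1 (wc_d n x);
  wc_dR : forall n x, wc_R n (wc_d n.+1 x) = wc_d n (wc_R n x);
  wc_dM : forall n i x y, wc_deg i x ->
    wc_d n (x * y) = wc_d n x * y + (-1) ^+ i * (x * wc_d n y);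

  wc_FdV : forall n x, wc_F n (wc_d n.+1 (wc_V n x)) = wc_d n x + wc_iota x;
  wc_dd : forall n x, wc_d n (wc_d n x) = wc_d n (wc_iota x);
  wc_d_iota : forall n x, wc_d n (wc_iota x) = wc_iota (wc_d n x);
  wc_Fd_teich : forall n (a : A),
    wc_F n (wc_d n.+1 (wc_lam n.+1 (teich n.+1 a))) =
    wc_lam n (teich n a) * wc_d n (wc_lam n (teich n a)) }.

Record witt_complex_morphism (A : comPzRingType) (E E' : witt_complex A)
    (f : forall n, {rmorphism E n -> E' n}) : Prop := WittComplexMorphism {
  wcm_deg : forall n i x, wc_deg i x -> wc_deg i (f n x);
  wcm_R : forall n x, f n (wc_R E n x) = wc_R E' n (f n.+1 x);
  wcm_lam : forall n a, f n (wc_lam E n a) = wc_lam E' n a;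
  wcm_d : forall n x, f n (wc_d E n x) = wc_d E' n (f n x);
  wcm_F : forall n x, f n (wc_F E n x) = wc_F E' n (f n.+1 x);
  wcm_V : forall n x, f n.+1 (wc_V E n x) = wc_V E' n (f n x) }.

(* E is an initial object of the category of Witt complexes over A. *)
Definition is_de_rham_witt (A : comPzRingType) (E : witt_complex A) : Prop :=
  forall E' : witt_complex A,
    (exists f : forall n, {rmorphism E n -> E' n}, witt_complex_morphism f) /\
    (forall f g : forall n, {rmorphism E n -> E' n},
       witt_complex_morphism f -> witt_complex_morphism g ->
       forall n x, f n x = g n x).

(* V^i([1]_{n-i}) in E_n, for i <= n. *)
Fixpoint V1 (A : comPzRingType) (E : witt_complex A) (i n : nat) : E n :=
  match i, n return E n with
  | 0%N, _ => wc_lam E n (teich n 1)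
  | j.+1, m.+1 => wc_V E m (V1 E j m)
  | _.+1, 0%N => 0
  end.

Definition dV1 (A : comPzRingType) (E : witt_complex A) (i n : nat) : E n :=
  wc_d E n (V1 E i n).

(* The subgroup P of M is the internal direct sum of copies of the groups G i,
   embedded so that g i corresponds to e i. *)
Definition direct_sum_on (M : zmodType) (P : M -> Prop) (I : finType)
    (G : I -> zmodType) (g : forall i, G i) (e : I -> M) : Prop :=
  exists j : forall i, {additive G i -> M},
    [/\ forall i, j i (g i) = e i,
        forall i c, P (j i c)
      & forall x, P x ->
          exists! c : {dffun forall i : I, G i}, x = \sum_i j i (c i)].

Arguments direct_sum_on {M} P {I} G g e.

(* Main.v *)
From HB Require Import structures.
Require Import Defs.
From mathcomp Require Import all_boot all_order all_algebra.
From mathcomp Require Import ring zify.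

(* The relations among the V^i(1) and dV^i(1) hold in every Witt complex: with
   eta = dlog [-1] = iota(1) one has 2 eta = 0, F eta = eta, V(dx) = 2 dV(x) for
   x of degree 0, and [-1] = -1 + V(1) gives eta = dV(1) + V(eta), hence
   eta = sum_s 2^(s-1) dV^s(1); the products dV^i(1) dV^j(1) vanish by induction
   on the level.  It remains to see that there are no further relations.  By
   Dwork's congruences W_n(Z_(2)) is free over Z_(2) on the V^i(1), and the
   formulas define a Witt complex structure on the square-zero extension of
   W_n(Z_(2)) by the sum of the Z/2^i dV^i(1).  By the relations this complex maps
   to every other one, uniquely since the V^i(1) and dV^i(1) generate it, so it
   is initial. *)

Set Implicit Arguments.
Unset Strict Implicit.
Unset Printing Implicit Defensive.

Import GRing.Theory Num.Theory.
Local Open Scope ring_scope.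

(** * Reduction of Z_(2) modulo powers of 2 *)

(** The coefficients of the dV^s(1) live in different rings Z/2^s, and the formulas mix them, so the
    model is computed on lifts to Z_(2). This works because every mixing term has the form 2^t b on
    the coordinate of index t, which is taken modulo 2^(t+1): only the parity of b matters, and
    parities of different coordinates can be added. The axioms of the model then rest on a few facts
    modulo 2: all ghost components of a Witt vector agree, squares are trivial, and F(x) has even
    coefficients on V(1), V^2(1), ... Identities in W_n(Z_(2)) itself are checked on ghost
    components. A Witt complex carries no explicit Z_(2)-action. It comes from the ring map Z_(2) ->
    W_n(Z_(2)) with constant ghost vectors, and d kills its image because every element of Z_(2) is
    an integer over an odd one. As the relations hold in all Witt complexes, they hold in the model
    too, so the comparison map respects products because both sides are given by the same
    formula. *)

Lemma Z2val_inj : injective Z2val.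
Proof. exact: val_inj. Qed.
Lemma Z2valM (a b : Z2loc) : Z2val (a * b) = Z2val a * Z2val b.
Proof. by []. Qed.
Lemma Z2val_nat k : Z2val k%:R = k%:R.
Proof. by elim: k => // k IHk; rewrite !mulrS -IHk. Qed.
Lemma Z2val_int p : Z2val p%:~R = p%:~R.
Proof.
case: p => p; first by rewrite -!pmulrn Z2val_nat.
by rewrite !NegzE !rmorphN /= -!pmulrn Z2val_nat.
Qed.
Lemma Z2valX (a : Z2loc) k : Z2val (a ^+ k) = Z2val a ^+ k.
Proof. by elim: k => // k IHk; rewrite !exprS -IHk. Qed.

Lemma expr2_neq0 k : 2 ^+ k != 0 :> rat.
Proof. by rewrite expf_neq0. Qed.

Definition dvd2 k (a : Z2loc) : bool := Z2val a / 2 ^+ k \in Z2loc_pred.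
Definition quo2 k (a : Z2loc) : Z2loc := insubd 0 (Z2val a / 2 ^+ k).

Lemma mul2I k : injective (fun a : Z2loc => 2 ^+ k * a).
Proof.
move=> a b /(congr1 Z2val); rewrite !Z2valM Z2valX Z2val_nat.
by move/(mulfI (expr2_neq0 k))/Z2val_inj.
Qed.

Lemma quo2E k (a : Z2loc) : quo2 k (2 ^+ k * a) = a.
Proof.
apply: Z2val_inj; rewrite val_insubd /= mulrAC mulrC Z2valX Z2val_nat.
by rewrite divff ?expr2_neq0 // mulr1 (valP a).
Qed.

Lemma dvd2P k (a : Z2loc) : reflect (exists c, a = 2 ^+ k * c) (dvd2 k a).
Proof.
apply: (iffP idP) => [ka | [c ->]].
  exists (MkZ2loc ka); apply: Z2val_inj; rewrite Z2valM Z2valX Z2val_nat /=.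
  by rewrite mulrC divfK ?expr2_neq0.
rewrite /dvd2 Z2valM Z2valX Z2val_nat mulrAC mulrC.
by rewrite divff ?expr2_neq0 // mulr1 (valP c).
Qed.

Lemma quo2K k (a : Z2loc) : dvd2 k a -> 2 ^+ k * quo2 k a = a.
Proof. by case/dvd2P=> c ->; rewrite quo2E. Qed.

Lemma Z2loc_fraction (a : Z2loc) : exists (p : int) (q : nat) (u : Z2loc),
  a * q%:R = p%:~R /\ q%:R * u = 1.
Proof.
have /Z2loc_predP[p [q [oq Eq]]] := valP a.
have uP : (q%:R^-1 : rat) \in Z2loc_pred.
  by apply/Z2loc_predP; exists 1, q; rewrite mulVf // pnatr_eq0; case: q oq {Eq}.
exists p, q, (MkZ2loc uP); split; apply: Z2val_inj => /=.
  by rewrite Z2val_nat Z2val_int.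
by rewrite Z2val_nat mulfV // pnatr_eq0; case: q oq {Eq uP}.
Qed.

Lemma Z2loc_parity (a : Z2loc) : exists (b : bool) (c : Z2loc), a = b%:R + 2 * c.
Proof.
have /Z2loc_predP[p [q [oq Eq]]] := valP a.
(* As q is odd, p - b q is even exactly when b is the parity of p. *)
exists (odd `|p|%N).
suff /dvd2P[c Ec] : dvd2 1 (a - (odd `|p|%N)%:R).
  by exists c; rewrite -[2]expr1 -Ec addrC subrK.
rewrite /dvd2; apply/Z2loc_predP.
have [p' Ep] : exists p' : int, p - (odd `|p|%N)%:Z * q%:Z = 2 * p'.
  exists ((p - (odd `|p|%N)%:Z * q%:Z) %/ 2)%Z.
  by move: oq; lia.
exists p', q; split=> //.
have {Eq} Eq : Z2val a * q%:R = p%:~R by [].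
apply: (mulfI (expr2_neq0 1)); rewrite expr1.
have <- : (2 * p')%:~R = 2 * p'%:~R :> rat by rewrite rmorphM.
rewrite -Ep rmorphB rmorphM /= -Eq.
by rewrite Z2val_nat -!pmulrn; field.
Qed.

Lemma Z2loc_residue k (a : Z2loc) : exists (r : nat), dvd2 k (a - r%:R).
Proof.
elim: k a => [|k IHk] a.
  by exists 0%N; apply/dvd2P; exists a; rewrite subr0 mul1r.
have [b [c Ea]] := Z2loc_parity a; have [r /dvd2P[e Ec]] := IHk c.
exists (b + 2 * r)%N; apply/dvd2P; exists e.
have {}Ec : c = r%:R + 2 ^+ k * e by rewrite -Ec addrC subrK.
by rewrite Ea Ec natrD natrM exprS; ring.
Qed.

Lemma dvd2_0 k : dvd2 k 0.
Proof. by apply/dvd2P; exists 0; rewrite mulr0. Qed.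
Lemma dvd2D k a b : dvd2 k a -> dvd2 k b -> dvd2 k (a + b).
Proof.
by case/dvd2P=> c -> /dvd2P[e ->]; apply/dvd2P; exists (c + e); rewrite mulrDr.
Qed.
Lemma dvd2N k a : dvd2 k (- a) = dvd2 k a.
Proof. by apply/dvd2P/dvd2P=> -[c E]; exists (- c); rewrite mulrN -E ?opprK. Qed.
Lemma dvd2Mr k a b : dvd2 k b -> dvd2 k (a * b).
Proof. by case/dvd2P=> c ->; apply/dvd2P; exists (a * c); rewrite mulrCA. Qed.

(** The cofactor is a fraction whose denominator q is a unit of Z_(2), hence odd; after
    multiplication by q the divisibility is one of integers, and q is coprime to 2^k. *)
Lemma dvd2_nat k r : dvd2 k r%:R = (2 ^ k %| r)%N.
Proof.
apply/dvd2P/idP => [[c]|/dvdnP[q ->]]; last first.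
  by exists q%:R; rewrite natrM natrX mulrC.
have [p [q [u [Ec qu]]]] := Z2loc_fraction c => Er.
have oq : odd q.
  apply/negPn/negP=> q2; have {q2} Eq : q = (2 * q./2)%N by lia.
  have : dvd2 1 1.
    by apply/dvd2P; exists (q./2%:R * u); rewrite expr1 mulrA -natrM -Eq qu.
  rewrite /dvd2 => /Z2loc_predP[a [b [ob /(congr1 ( *%R 2))]]].
  have -> : Z2val 1 / 2 ^+ 1 = 2^-1 by rewrite expr1 mul1r.
  rewrite mulrA divff // mul1r -{1}(rmorphM intr 2 a) => /eqP.
  by rewrite pmulrn eqr_int => /eqP; move: ob; lia.
have : (2 ^ k %| r * q)%N.
  have : (r * q)%:R = 2 ^+ k * p%:~R :> Z2loc by rewrite natrM Er -mulrA Ec.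
  move/(congr1 Z2val); rewrite Z2val_nat Z2valM Z2valX Z2val_nat.
  rewrite Z2val_int -natrX !pmulrn -intrM => /eqP; rewrite eqr_int => /eqP E.
  have : ((2 ^ k)%N%:Z %| (r * q)%N%:Z)%Z by rewrite E dvdz_mulr.
  by rewrite dvdzE.
by rewrite Gauss_dvdl // coprimeXl // coprime2n.
Qed.

Definition res2 k (a : Z2loc) : nat := ex_minn (Z2loc_residue k a).

Lemma res2P k (a : Z2loc) : dvd2 k (a - (res2 k a)%:R).
Proof. by rewrite /res2; case: ex_minnP. Qed.

(* The exponents start at 1 because 'Z_(2 ^ 0) is Z/2. *)
Notation Zt t := 'Z_(2 ^ t.+1).

Lemma exp2_gt1 t : (1 < 2 ^ t.+1)%N.
Proof. by rewrite -{1}(expn0 2) ltn_exp2l. Qed.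

Lemma Zt_nat_eq t (r s : nat) : (r%:R == s%:R :> Zt t) = (r == s %[mod 2 ^ t.+1]).
Proof. by rewrite !Zp_nat -val_eqE /= Zp_cast // exp2_gt1. Qed.

HB.lock Definition redZ t (a : Z2loc) : Zt t := (res2 t.+1 a)%:R.

Lemma redZ_nat t a (r : nat) : dvd2 t.+1 (a - r%:R) -> redZ t a = r%:R.
Proof.
move=> ar; apply/eqP; rewrite redZ.unlock Zt_nat_eq.
have : dvd2 t.+1 ((res2 t.+1 a)%:R - r%:R).
  have -> : (res2 t.+1 a)%:R - r%:R = (a - r%:R) - (a - (res2 t.+1 a)%:R) :> Z2loc.
    by ring.
  by rewrite dvd2D // dvd2N res2P.
have [le|lt] := leqP r (res2 t.+1 a).
  by rewrite -natrB // dvd2_nat eqn_mod_dvd.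
rewrite -dvd2N opprB -natrB 1?ltnW // dvd2_nat.
by rewrite eq_sym -eqn_mod_dvd 1?ltnW.
Qed.

Lemma redZ_res t a : redZ t a = (res2 t.+1 a)%:R.
Proof. by rewrite redZ.unlock. Qed.

Fact redZ_nmod t : nmod_morphism (redZ t).
Proof.
split=> [|a b]; first by rewrite (@redZ_nat _ _ 0%N) // subr0 (dvd2_nat _ 0).
rewrite !redZ_res -natrD -redZ_res; apply: redZ_nat; rewrite natrD opprD addrACA.
by rewrite dvd2D ?res2P.
Qed.
Fact redZ_monoid t : monoid_morphism (redZ t).
Proof.
split=> [|a b]; first by rewrite (@redZ_nat _ _ 1%N) // subrr (dvd2_nat _ 0).
rewrite !redZ_res -natrM; rewrite -redZ_res; apply: redZ_nat; rewrite natrM.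
set r := _%:R; set s := _%:R.
have -> : a * b - r * s = a * (b - s) + s * (a - r) by ring.
by rewrite dvd2D // dvd2Mr ?res2P.
Qed.
HB.instance Definition _ t :=
  GRing.isNmodMorphism.Build Z2loc (Zt t) (redZ t) (redZ_nmod t).
HB.instance Definition _ t :=
  GRing.isMonoidMorphism.Build Z2loc (Zt t) (redZ t) (redZ_monoid t).

Lemma redZ_eq t a b : (redZ t a == redZ t b) = dvd2 t.+1 (a - b).
Proof.
rewrite -subr_eq0 -rmorphB /=; set c := a - b.
have cr := res2P t.+1 c.
have -> : (redZ t c == 0) = dvd2 t.+1 (res2 t.+1 c)%:R.
  by rewrite redZ.unlock dvd2_nat (Zt_nat_eq t _ 0) mod0n.
apply/idP/idP => h; first by rewrite -(subrK (res2 t.+1 c)%:R c) dvd2D.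
by rewrite -(subKr c (res2 t.+1 c)%:R) dvd2D ?dvd2N.
Qed.

Lemma redZ_val t (z : Zt t) : redZ t (z : nat)%:R = z.
Proof. by rewrite rmorph_nat natr_Zp. Qed.

Lemma redZ_exp2 t : redZ t (2 ^+ t.+1) = 0.
Proof.
apply/eqP; rewrite -(rmorph0 (redZ t)) redZ_eq subr0 -natrX dvd2_nat //.
Qed.

Lemma redZW t a b : redZ t.+1 a = redZ t.+1 b -> redZ t a = redZ t b.
Proof.
move/eqP; rewrite redZ_eq => /dvd2P[c E]; apply/eqP; rewrite redZ_eq.
by apply/dvd2P; exists (2 * c); rewrite E exprS mulrA [2 * _]mulrC -!mulrA.
Qed.

Lemma redZ_double t a b : redZ t a = redZ t b -> redZ t.+1 (2 * a) = redZ t.+1 (2 * b).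
Proof.
move/eqP; rewrite redZ_eq => /dvd2P[c E]; apply/eqP; rewrite redZ_eq.
by apply/dvd2P; exists c; rewrite -mulrBr E mulrA -exprS.
Qed.

Lemma redZ_parity t a b : dvd2 1 (a - b) -> redZ t (2 ^+ t * a) = redZ t (2 ^+ t * b).
Proof.
case/dvd2P=> c E; apply/eqP; rewrite redZ_eq -mulrBr E.
by apply/dvd2P; exists c; rewrite mulrA -exprD addn1.
Qed.

Lemma redZ_dvd1 t a b : redZ t a = redZ t b -> dvd2 1 (a - b).
Proof.
move/eqP; rewrite redZ_eq => /dvd2P[c E].
by apply/dvd2P; exists (2 ^+ t * c); rewrite E mulrA -exprD.
Qed.

(** * Witt vectors of Z_(2) *)

Section GhostRing.
Variables (A : comPzRingType) (n k : nat).
Hypothesis ltkn : (k < n)%N.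
Implicit Types x y : witt A n.

Lemma ghostD x y : ghost k (x + y) = ghost k x + ghost k y.
Proof. exact: wadd_ghost. Qed.
Lemma ghostN x : ghost k (- x) = - ghost k x.
Proof. exact: wopp_ghost. Qed.
Lemma ghostM x y : ghost k (x * y) = ghost k x * ghost k y.
Proof. exact: wmul_ghost. Qed.
Lemma ghost1 : ghost k (1 : witt A n) = 1.
Proof. by rewrite -[1]/(teich n 1) ghost_teich // expr1n. Qed.
Lemma ghost0 : ghost k (0 : witt A n) = 0.
Proof. exact: ghost_zero. Qed.
Lemma ghostMn x m : ghost k (x *+ m) = ghost k x *+ m.
Proof. by elim: m => [|m IHm]; rewrite ?ghost0 // !mulrS ghostD IHm. Qed.
End GhostRing.

Lemma ghost_wittV0 (A : comPzRingType) n (x : witt A n) : ghost 0 (wittV x) = 0.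
Proof. exact: ghost_cons0. Qed.

Lemma ghost_wittVS (A : comPzRingType) n k (x : witt A n) :
  ghost k.+1 (wittV x) = ghost k x *+ 2.
Proof. by rewrite ghost_consS expr0n expn_eq0 add0r. Qed.

Lemma ghost_wittR (A : comPzRingType) n k (x : witt A n.+1) :
  (k < n)%N -> ghost k (wittR x) = ghost k x.
Proof.
move=> ltkn; rewrite /ghost [RHS]big_mkcond big_ord_recr /= leqNgt ltkn addr0.
by rewrite -big_mkcond /=; apply: eq_bigr => i _; rewrite tnth_mktuple.
Qed.

Lemma Z2loc_tf (a : Z2loc) : a *+ 2 = 0 -> a = 0.
Proof.
by move=> E; apply: (@mul2I 1); rewrite /= mulr0 expr1 mulr_natl.
Qed.

Lemma witt_ext n (x y : witt Z2loc n) :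
  (forall k, (k < n)%N -> ghost k x = ghost k y) -> x = y.
Proof. exact: ghost_inj Z2loc_tf. Qed.

Lemma dvd2_sqr_sub (a : Z2loc) : dvd2 1 (a ^+ 2 - a).
Proof.
have [b [c ->]] := Z2loc_parity a.
by apply/dvd2P; exists (2 * b%:R * c + 2 * c ^+ 2 - c); case: b => /=; ring.
Qed.

Lemma dvd2_sqr k (a b : Z2loc) : dvd2 k.+1 (a - b) -> dvd2 k.+2 (a ^+ 2 - b ^+ 2).
Proof.
case/dvd2P=> c E; apply/dvd2P; exists (c * (b + 2 ^+ k * c)).
have -> : a = b + 2 ^+ k.+1 * c by rewrite -E addrC subrK.
by rewrite !exprS; ring.
Qed.

(** Starting from a^2 = a modulo 2, each squaring of a congruence gains one factor 2. *)
Lemma dvd2_pow (a : Z2loc) k : dvd2 k.+1 (a ^+ (2 ^ k.+1) - a ^+ (2 ^ k)).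
Proof.
elim: k => [|k IHk]; first exact: dvd2_sqr_sub.
by rewrite !(expnSr 2 _.+1) (expnSr 2 k) !exprM dvd2_sqr // -!exprM -!expnSr.
Qed.

Lemma dvd2_mul2 k (a : Z2loc) : dvd2 k.+1 (a *+ 2) = dvd2 k a.
Proof.
apply/dvd2P/dvd2P => -[c E]; exists c; last by rewrite E exprS -mulrA mulr_natl.
by apply: (@mul2I 1); rewrite /= expr1 mulr_natl E exprS mulrA.
Qed.

Lemma quo2K1 (a : Z2loc) : dvd2 1 a -> quo2 1 a *+ 2 = a.
Proof. by move/quo2K=> E; rewrite -[RHS]E expr1 mulr_natl. Qed.

Lemma dvd2W k (a : Z2loc) : dvd2 k.+1 a -> dvd2 k a.
Proof.
by case/dvd2P=> c ->; apply/dvd2P; exists (2 * c); rewrite exprSr mulrA.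
Qed.

(* Dwork's congruences: since the identity of Z_(2) lifts Frobenius, a sequence
   is a ghost vector iff its consecutive terms k, k+1 agree modulo 2^(k+1). *)
Lemma ghost_dwork n k (x : witt Z2loc n) : dvd2 k.+1 (ghost k.+1 x - ghost k x).
Proof.
elim: n k x => [|n IHn] k x.
  by rewrite /ghost !big_ord0 subrr dvd2_0.
rewrite -(wcons_eta x) ghost_consS; case: k => [|k].
  rewrite ghost_cons0 addrAC dvd2D ?dvd2_sqr_sub //.
  by rewrite dvd2_mul2; apply/dvd2P; exists (ghost 0 (wtail x)); rewrite mul1r.
rewrite ghost_consS opprD addrACA -mulrnBl dvd2D ?dvd2_mul2 ?IHn //.
exact: dvd2_pow.
Qed.

(** Solves the ghost equations for g one component at a time: by [ghost_consS] the tail must have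
    the ghost components (g_(k+1) - g_0^(2^(k+1))) / 2. *)
Fixpoint wdwork n (g : nat -> Z2loc) : witt Z2loc n :=
  match n with
  | 0%N => [tuple]
  | m.+1 => wcons (g 0%N) (wdwork m (fun k => quo2 1 (g k.+1 - g 0%N ^+ (2 ^ k.+1))))
  end.

Lemma ghost_wdwork n k (g : nat -> Z2loc) :
  (forall i, dvd2 i.+1 (g i.+1 - g i)) -> (k < n)%N -> ghost k (wdwork n g) = g k.
Proof.
elim: n k g => // n IHn [|k] g dg ltkn; first exact: ghost_cons0.
(* All terms of g have the parity of g_0, and so have the powers of g_0; hence the halving is
   exact. *)
have dg0 i : dvd2 1 (g i.+1 - g 0%N ^+ (2 ^ i.+1)).
  have W j (a : Z2loc) : dvd2 j.+1 a -> dvd2 1 a by elim: j => // j IHj /dvd2W/IHj.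
  elim: i => [|i IHi].
    rewrite -(subrK (g 0%N) (g 1%N)) -addrA dvd2D // -opprB dvd2N.
    exact: dvd2_sqr_sub.
  have := dvd2_pow (g 0%N) i.+1; move/(W _); rewrite -dvd2N opprB => d1.
  rewrite -(subrK (g i.+1) (g i.+2)) -addrA dvd2D //; first exact: W (dg i.+1).
  rewrite -(subrK (g 0%N ^+ (2 ^ i.+1)) (g i.+1)) -addrA.
  exact: dvd2D.
rewrite ghost_consS IHn //; last first.
  (* The halved sequence satisfies the congruences again: doubling them leaves those of g, shifted
     by one, and those of the powers of g_0. *)
  move=> i; rewrite -dvd2_mul2 mulrnBl !quo2K1 //.
  rewrite opprD opprK addrACA dvd2D //.
  by rewrite addrC -opprB dvd2N dvd2_pow.
by rewrite quo2K1 // addrC subrK.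
Qed.

(** The structure map of W_n(Z_(2)) as a Z_(2)-algebra; the Teichmuller map would not be
    additive. *)
Definition wconst n (a : Z2loc) : witt Z2loc n := wdwork n (fun=> a).

Lemma ghost_wconst n k a : (k < n)%N -> ghost k (wconst n a) = a.
Proof.
move=> ltkn; rewrite ghost_wdwork // => i.
by rewrite subrr dvd2_0.
Qed.

Fact wconst_nmod n : nmod_morphism (wconst n).
Proof.
by split=> [|a b]; apply: witt_ext => k ltkn;
  rewrite ?ghostD ?ghost0 ?ghost_wconst.
Qed.
Fact wconst_monoid n : monoid_morphism (wconst n).
Proof.
by split=> [|a b]; apply: witt_ext => k ltkn;
  rewrite ?ghostM ?ghost1 ?ghost_wconst.
Qed.
HB.instance Definition _ n :=
  GRing.isNmodMorphism.Build Z2loc (witt Z2loc n) (wconst n) (wconst_nmod n).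
HB.instance Definition _ n :=
  GRing.isMonoidMorphism.Build Z2loc (witt Z2loc n) (wconst n) (wconst_monoid n).

(** The coefficient of x on V^k(1): the ghost components of V^i(1) are 0 before place i and 2^i from
    there on, so the jump from place k-1 to place k is 2^k times this coefficient. *)
Definition wcoef n (x : witt Z2loc n) k : Z2loc :=
  if k is j.+1 then quo2 k (ghost k x - ghost j x) else ghost 0 x.

Arguments wcoef : simpl never.

Lemma ghostS n k (x : witt Z2loc n) :
  ghost k.+1 x = ghost k x + 2 ^+ k.+1 * wcoef x k.+1.
Proof. by rewrite quo2K ?ghost_dwork // addrC subrK. Qed.

Lemma wcoefS n k (x : witt Z2loc n) c :
  ghost k.+1 x = ghost k x + 2 ^+ k.+1 * c -> wcoef x k.+1 = c.
Proof. by move=> E; rewrite /wcoef E addrAC subrr add0r quo2E. Qed.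

Lemma ghost_sum_wcoef n k (x : witt Z2loc n) :
  ghost k x = \sum_(i < k.+1) 2 ^+ i * wcoef x i.
Proof.
elim: k => [|k IHk]; first by rewrite big_ord1 mul1r.
by rewrite big_ord_recr -IHk ghostS.
Qed.

Fixpoint wV1 (A : comPzRingType) (i n : nat) : witt A n :=
  match i, n with
  | 0%N, _ => teich n 1
  | j.+1, m.+1 => wittV (wV1 A j m)
  | _.+1, 0%N => 0
  end.

Lemma ghost_wV1 (A : comPzRingType) i n k : (k < n)%N ->
  ghost k (wV1 A i n) = (if (i <= k)%N then 2 ^+ i else 0).
Proof.
elim: i n k => [|i IHi] [|n] [|k] //= ltkn.
- by rewrite ghost_cons0.
- by rewrite ghost_consS ghost_zero mul0rn addr0 expr1n.
- by rewrite ghost_wittV0.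
rewrite ghost_wittVS IHi // ltnS; case: ifP => _; last by rewrite mul0rn.
by rewrite exprS mulr_natl.
Qed.

Lemma witt_expansion n (x : witt Z2loc n) :
  x = \sum_(i < n) wconst n (wcoef x i) * wV1 Z2loc i n.
Proof.
apply: witt_ext => k ltkn; rewrite ghost_sum_wcoef.
rewrite (big_morph (ghost k) (ghostD ltkn) (ghost0 _ _ _)).
rewrite (big_ord_widen n (fun i => 2 ^+ i * wcoef x i)) // big_mkcond.
apply: eq_bigr => i _; rewrite ghostM // ghost_wconst // ghost_wV1 // ltnS.
by case: ifP; rewrite ?mulr0 // mulrC.
Qed.

(** * Coefficients on the V^i(1) and their parities *)

Section Coefficients.
Variable n : nat.
Implicit Types (x y : witt Z2loc n) (k : nat).

Lemma wcoefD k x y : (k < n)%N -> wcoef (x + y) k = wcoef x k + wcoef y k.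
Proof.
case: k => [|k] ltkn; first exact: ghostD.
by apply: wcoefS; rewrite !ghostD ?(ltnW ltkn) // !ghostS; ring.
Qed.

Lemma wcoef0 k : (k < n)%N -> wcoef (0 : witt Z2loc n) k = 0.
Proof.
case: k => [|k] ltkn; first exact: ghost0.
by apply: wcoefS; rewrite !ghost0 ?(ltnW ltkn) // mulr0 addr0.
Qed.

Lemma wcoef1 k : (k.+1 < n)%N -> wcoef (1 : witt Z2loc n) k.+1 = 0.
Proof. by move=> ltkn; apply: wcoefS; rewrite !ghost1 ?(ltnW ltkn) // mulr0 addr0. Qed.

Lemma wcoefM k x y : (k.+1 < n)%N -> wcoef (x * y) k.+1 =
  wcoef x k.+1 * ghost k y + ghost k x * wcoef y k.+1
  + 2 ^+ k.+1 * (wcoef x k.+1 * wcoef y k.+1).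
Proof. by move=> ltkn; apply: wcoefS; rewrite !ghostM ?(ltnW ltkn) // !ghostS; ring. Qed.

Lemma ghost_parity k x : dvd2 1 (ghost k x - ghost 0 x).
Proof.
elim: k => [|k IHk]; first by rewrite subrr dvd2_0.
rewrite ghostS addrAC dvd2D //; apply/dvd2P; exists (2 ^+ k * wcoef x k.+1).
by rewrite mulrA -exprD.
Qed.

(* Modulo 2, the sum of the coefficients of x on V(1), ..., V^k(1) is a
   derivation over the reduction of x; it measures the failure of the action of
   x on dV^j(1) to be multiplication by a ghost component. *)
Definition wpar k x : Z2loc := \sum_(i < k) wcoef x i.+1.

Lemma wparS k x : wpar k.+1 x = wpar k x + wcoef x k.+1.
Proof. exact: big_ord_recr. Qed.

Lemma wparD k x y : (k < n)%N -> wpar k (x + y) = wpar k x + wpar k y.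
Proof.
move=> ltkn; rewrite -big_split; apply: eq_bigr => i _; rewrite wcoefD //.
by rewrite (leq_ltn_trans _ ltkn).
Qed.

Lemma wpar1 k : (k < n)%N -> wpar k (1 : witt Z2loc n) = 0.
Proof.
move=> ltkn; apply: big1 => i _; rewrite wcoef1 //.
by rewrite (leq_ltn_trans _ ltkn).
Qed.

Lemma wparM k x y : (k < n)%N ->
  dvd2 1 (wpar k (x * y) - (ghost 0 x * wpar k y + wpar k x * ghost 0 y)).
Proof.
elim: k => [|k IHk] ltkn.
  by rewrite /wpar !big_ord0 mulr0 mul0r addr0 subrr dvd2_0.
rewrite !wparS wcoefM //.
have /dvd2P[c E] := IHk (ltnW ltkn).
(* Modulo 2 the last term of [wcoefM] vanishes and the ghost components at k may be replaced by
   those at 0. *)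
have /dvd2P[a Ea] := ghost_parity k x; have /dvd2P[b Eb] := ghost_parity k y.
have {}E : wpar k (x * y) = ghost 0 x * wpar k y + wpar k x * ghost 0 y + 2 ^+ 1 * c.
  by rewrite -E addrC subrK.
have {}Ea : ghost k x = ghost 0 x + 2 ^+ 1 * a by rewrite -Ea addrC subrK.
have {}Eb : ghost k y = ghost 0 y + 2 ^+ 1 * b by rewrite -Eb addrC subrK.
apply/dvd2P; exists (c + a * wcoef y k.+1 + wcoef x k.+1 * b
  + 2 ^+ k * (wcoef x k.+1 * wcoef y k.+1)).
by rewrite E Ea Eb (exprS 2 k); ring.
Qed.

End Coefficients.

Section WittOperators.
Variable n : nat.

Lemma wcoef_F k (x : witt Z2loc n.+1) : (k.+1 < n)%N ->
  wcoef (wittF x) k.+1 = 2 * wcoef x k.+2.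
Proof.
move=> ltkn; apply: wcoefS; rewrite !wittF_ghost ?(ltnW ltkn) // [LHS]ghostS.
by rewrite exprSr mulrA.
Qed.

Lemma wcoef_VS k (x : witt Z2loc n) : wcoef (wittV x) k.+1 = wcoef x k.
Proof.
apply: wcoefS; case: k => [|k]; rewrite ghost_wittVS.
  by rewrite ghost_wittV0 add0r expr1 mulr_natl.
by rewrite ghost_wittVS ghostS mulrnDl (exprS _ k.+1) -mulrA [2 * _]mulr_natl.
Qed.

Lemma wcoef_R k (x : witt Z2loc n.+1) : (k < n)%N -> wcoef (wittR x) k = wcoef x k.
Proof.
case: k => [|k] ltkn; first exact: ghost_wittR.
by apply: wcoefS; rewrite !ghost_wittR ?(ltnW ltkn) // ghostS.
Qed.

Fact wittR_nmod : nmod_morphism (@wittR Z2loc n).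
Proof.
by split=> [|x y]; apply: witt_ext => k ltkn;
  rewrite ?ghostD ?ghost_wittR ?ghost0 ?ghostD // ltnW.
Qed.
Fact wittR_monoid : monoid_morphism (@wittR Z2loc n).
Proof.
by split=> [|x y]; apply: witt_ext => k ltkn;
  rewrite ?ghostM ?ghost_wittR ?ghost1 ?ghostM // ltnW.
Qed.
Fact wittF_nmod : nmod_morphism (@wittF Z2loc n).
Proof.
split=> [|x y]; apply: witt_ext => k ltkn; rewrite wittF_ghost ?ghost0 //.
by rewrite [LHS]ghostD // [RHS]ghostD // !wittF_ghost.
Qed.
Fact wittF_monoid : monoid_morphism (@wittF Z2loc n).
Proof.
split=> [|x y]; apply: witt_ext => k ltkn; rewrite wittF_ghost ?ghost1 //.
by rewrite [LHS]ghostM // [RHS]ghostM // !wittF_ghost.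
Qed.
Fact wittV_nmod : nmod_morphism (@wittV Z2loc n).
Proof.
split=> [|x y]; apply: witt_ext => -[|k] ltkn;
  rewrite ?ghostD ?ghost0 ?ghost_wittV0 ?ghost_wittVS ?ghost0 ?ghostD ?mul0rn //.
  by rewrite addr0.
exact: mulrnDl.
Qed.

Lemma wittVM (x : witt Z2loc n) (y : witt Z2loc n.+1) :
  wittV x * y = wittV (x * wittF y).
Proof.
apply: witt_ext => -[|k] ltkn; rewrite ghostM // ?ghost_wittV0 ?mul0r //.
by rewrite !ghost_wittVS ghostM // wittF_ghost // mulrnAl.
Qed.

Lemma wittFV (x : witt Z2loc n) : wittF (wittV x) = x *+ 2.
Proof. by apply: witt_ext => k ltkn; rewrite wittF_ghost // ghost_wittVS ghostMn. Qed.

End WittOperators.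

Lemma wittFR n (x : witt Z2loc n.+2) : wittR (wittF x) = wittF (wittR x).
Proof.
apply: witt_ext => k ltkn; rewrite ghost_wittR // !wittF_ghost ?ghost_wittR //.
exact: ltnW.
Qed.

Lemma wittVR n (x : witt Z2loc n.+1) : wittR (wittV x) = wittV (wittR x).
Proof.
apply: witt_ext => k ltkn; rewrite ghost_wittR //; case: k ltkn => [|k] ltkn.
  by rewrite !ghost_wittV0.
by rewrite !ghost_wittVS ghost_wittR.
Qed.

HB.instance Definition _ n := GRing.isNmodMorphism.Build
  (witt Z2loc n.+1) (witt Z2loc n) (@wittR Z2loc n) (wittR_nmod n).
HB.instance Definition _ n := GRing.isMonoidMorphism.Build
  (witt Z2loc n.+1) (witt Z2loc n) (@wittR Z2loc n) (wittR_monoid n).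
HB.instance Definition _ n := GRing.isNmodMorphism.Build
  (witt Z2loc n.+1) (witt Z2loc n) (@wittF Z2loc n) (wittF_nmod n).
HB.instance Definition _ n := GRing.isMonoidMorphism.Build
  (witt Z2loc n.+1) (witt Z2loc n) (@wittF Z2loc n) (wittF_monoid n).
HB.instance Definition _ n := GRing.isNmodMorphism.Build
  (witt Z2loc n) (witt Z2loc n.+1) (@wittV Z2loc n) (wittV_nmod n).

(* (a_k) being the coefficients of [a], this is a^(2^(k+2)) = (a^(2^(k+1)))^2. *)
Lemma wcoef_teich n k a : (k.+2 < n)%N -> wcoef (teich n a) k.+2 =
  wcoef (teich n a) k.+1 * ghost k (teich n a)
  + 2 ^+ k * wcoef (teich n a) k.+1 ^+ 2.
Proof.
move=> ltkn; set x := teich n a; apply: wcoefS.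
have sq j : (j.+1 < n)%N -> ghost j.+1 x = ghost j x ^+ 2.
  by move=> ltjn; rewrite !ghost_teich ?(ltnW ltjn) // -exprM expnSr.
have E1 := sq k.+1 ltkn; rewrite E1 ghostS sqrrD -sq ?(ltnW ltkn) // ghostS.
rewrite !exprS; ring.
Qed.

(** * Relations in an arbitrary Witt complex *)

(** On ghost components this is -1 = -1 + 0 at place 0 and 1 = -1 + 2 at all others. *)
Lemma teichN1 (A : comPzRingType) n :
  teich n.+1 (-1) = -1 + wV1 A 1 n.+1 :> witt A n.+1.
Proof.
(* The three vectors are dummies; only the ring B without 2-torsion and its map to A are wanted. *)
case: (@witt_transfer A n.+1 0 0 0) => [/witt_trivial|]; first exact.
case=> B [f [_ [_ [_ [tf _ _ _]]]]].
have E : teich n.+1 (-1) = -1 + wV1 B 1 n.+1 :> witt B n.+1.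
  apply: ghost_inj => // -[|k] ltkn;
    rewrite [RHS]ghostD // ghostN // ghost1 // ghost_teich // ghost_wV1 //.
    by rewrite addr0.
  by rewrite expnS exprM sqrrN !expr1n expr1; ring.
have /(congr1 (@wmap _ _ f _)) := E; rewrite wmap_teich rmorphN1 => ->.
rewrite -[-1 + _]/(wadd (wopp (teich n.+1 1)) (wV1 B 1 n.+1)).
rewrite wmap_add wmap_opp wmap_teich rmorph1.
by rewrite wmap_cons rmorph0 wmap_teich rmorph1.
Qed.

Section WittComplexTheory.
Variables (A : comPzRingType) (E : witt_complex A).

Local Notation R := (wc_R E).
Local Notation F := (wc_F E).
Local Notation V := (wc_V E).
Local Notation d := (wc_d E).
Local Notation D i n := (dV1 E i n).
Local Notation "'V1" := (V1 E).

Section Level.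
Variable n : nat.
Implicit Types x y : E n.

Lemma wc_degD i x y : wc_deg i x -> wc_deg i y -> wc_deg i (x + y).
Proof.
move=> dx dy; rewrite -(opprK y); apply: (gr_sub (wc_graded E n)) => //.
rewrite -[- y]add0r; apply: (gr_sub (wc_graded E n)) => //.
exact: (gr_zero (wc_graded E n)).
Qed.

Lemma wc_deg_sum i (I : Type) (r : seq I) (P : pred I) (G : I -> E n) :
  (forall j, P j -> wc_deg i (G j)) -> wc_deg i (\sum_(j <- r | P j) G j).
Proof.
move=> dG; elim/big_rec: _ => [|j x Pj dx]; first exact: (gr_zero (wc_graded E n)).
by apply: wc_degD => //; apply: dG.
Qed.

Lemma wc_degMn i x m : wc_deg i x -> wc_deg i (x *+ m).
Proof.
move=> dx; elim: m => [|m IHm]; first exact: (gr_zero (wc_graded E n)).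
by rewrite mulrS; apply: wc_degD.
Qed.

Lemma wc_comm0 i x y : wc_deg 0 x -> wc_deg i y -> x * y = y * x.
Proof. by move=> dx dy; rewrite (gr_comm (wc_graded E n) dx dy) mul1r. Qed.

Lemma wc_dM0 x y : wc_deg 0 x -> d n (x * y) = d n x * y + x * d n y.
Proof. by move=> dx; rewrite [LHS](wc_dM _ dx) expr0 mul1r. Qed.

Lemma wc_d1 : d n 1 = 0.
Proof.
have := wc_dM0 1 (gr_one (wc_graded E n)).
by rewrite mulr1 mul1r mulr1 => /eqP; rewrite -subr_eq0 opprD addNKr oppr_eq0 => /eqP.
Qed.

Definition dlogN1 : E n := wc_iota 1.

Lemma wc_iotaE x : wc_iota x = dlogN1 * x.
Proof. by rewrite /dlogN1 /wc_iota mulr1. Qed.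

Lemma dlogN1_deg : wc_deg 1 dlogN1.
Proof.
rewrite /dlogN1 /wc_iota mulr1 -[1%N]addn0.
apply: (gr_mul (wc_graded E n)); last exact: wc_lam_deg.
exact/wc_d_deg/wc_lam_deg.
Qed.

Lemma lam_teichN1_sqr : wc_lam E n (teich n (-1)) * wc_lam E n (teich n (-1)) = 1.
Proof. by rewrite -rmorphM teichN1_inv rmorph1. Qed.

(** Differentiate [-1]^2 = 1. *)
Lemma dlogN1_double : dlogN1 *+ 2 = 0.
Proof.
have dL : wc_deg 0 (wc_lam E n (teich n (-1))) by apply: wc_lam_deg.
have := wc_dM0 (wc_lam E n (teich n (-1))) dL.
rewrite lam_teichN1_sqr wc_d1 (wc_comm0 dL (wc_d_deg dL)) -mulr2n.
by rewrite /dlogN1 /wc_iota mulr1 => <-.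
Qed.

(** Graded commutativity leaves a sign on each homogeneous part, which is immaterial since dlog[-1]
    is killed by 2. *)
Lemma dlogN1_comm x : dlogN1 * x = x * dlogN1.
Proof.
have [m [c [dc ->]]] := gr_span (wc_graded E n) x.
rewrite mulr_sumr mulr_suml; apply: eq_bigr => i _.
rewrite (gr_comm (wc_graded E n) dlogN1_deg (dc i)) mul1n -signr_odd.
case: (odd i); rewrite ?mul1r // expr1 mulN1r; apply/eqP.
by rewrite eqr_oppLR -addr_eq0 -mulrDr -mulr2n dlogN1_double mulr0.
Qed.

End Level.

(** F d[-1] = [-1] d[-1], while F[-1] = [(-1)^2] = 1. *)
Lemma F_dlogN1 n : F n (dlogN1 n.+1) = dlogN1 n.
Proof.
rewrite /dlogN1 /wc_iota !mulr1 rmorphM /= [X in X * _]wc_Fd_teich wc_lamF.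
have dL := wc_lam_deg E (teich n (-1)).
rewrite (_ : wittF _ = 1) ?rmorph1 ?mulr1; first exact: wc_comm0 dL (wc_d_deg dL).
by rewrite /wittF whead_cons wtail_cons sqrrN expr1n mul0rn addr0.
Qed.

Lemma F_dV1 n : F n (d n.+1 (V n 1)) = dlogN1 n.
Proof. by rewrite [LHS]wc_FdV wc_d1 add0r. Qed.

Lemma V_dlogN1 n x : V n (dlogN1 n * x) = dlogN1 n.+1 * V n x.
Proof.
by rewrite [RHS]dlogN1_comm wc_VM F_dlogN1 dlogN1_comm.
Qed.

Lemma V1M n x : V n 1 * x = V n (F n x).
Proof. by rewrite [LHS]wc_VM mul1r. Qed.

(** With eta = dlog[-1], applying V to dx = FdV(x) - eta x gives V(1) dV(x) - eta V(x). On the other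
    side, the Leibniz rule for V(1) V(x) = 2 V(x) gives 2 dV(x) = dV(1) V(x) + V(1) dV(x), where
    dV(1) V(x) = V(x FdV(1)) = eta V(x). The signs agree as 2 eta = 0. *)
Lemma V_d n x : wc_deg 0 x -> V n (d n x) = d n.+1 (V n x) *+ 2.
Proof.
move=> dx; have dVx := wc_V_deg dx; have d1 := gr_one (wc_graded E n).
have -> : d n x = F n (d n.+1 (V n x)) - dlogN1 n * x.
  by rewrite [F n _]wc_FdV wc_iotaE addrK.
rewrite raddfB /= -V1M V_dlogN1.
have := wc_dM0 (V n x) (wc_V_deg d1).
rewrite [V n 1 * V n x]V1M [F n (V n x)]wc_FV raddfMn raddfMn /= => ->.
rewrite -(wc_comm0 dVx (wc_d_deg (wc_V_deg d1))) [V n x * _]wc_VM F_dV1.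
rewrite -dlogN1_comm V_dlogN1 addrC; congr (_ + _).
apply/eqP; rewrite eq_sym -addr_eq0 -mulrDl -mulr2n dlogN1_double.
by rewrite mul0r.
Qed.

Lemma V10 n : 'V1 0 n = 1.
Proof. by rewrite /= -[teich n 1]/(1 : witt A n) rmorph1. Qed.

Lemma V1S i n : 'V1 i.+1 n.+1 = V n ('V1 i n).
Proof. by []. Qed.

Lemma V1_lam i n : 'V1 i n = wc_lam E n (wV1 A i n).
Proof.
elim: i n => [|i IHi] [|n] //=; first by rewrite rmorph0.
by rewrite IHi wc_lamV.
Qed.

Lemma V1_deg i n : wc_deg 0 ('V1 i n).
Proof. by rewrite V1_lam; apply: wc_lam_deg. Qed.

Lemma dV1_deg i n : wc_deg 1 (D i n).
Proof. exact/wc_d_deg/V1_deg. Qed.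

Lemma V1_ge i n : (n <= i)%N -> 'V1 i n = 0.
Proof.
elim: n i => [|n IHn] [|i] //= lein; first exact: wc_obj0.
by rewrite IHn // raddf0.
Qed.

Lemma dV1_ge i n : (n <= i)%N -> D i n = 0.
Proof. by move=> lein; rewrite /dV1 V1_ge // raddf0. Qed.

Lemma dV10 n : D 0 n = 0.
Proof. by rewrite /dV1 V10; apply: wc_d1. Qed.

Lemma V_dV1 i n : V n (D i n) = D i.+1 n.+1 *+ 2.
Proof. exact: V_d (V1_deg i n). Qed.

(** Iterating V(dx) = 2 dV(x) turns this into V^i(d1). *)
Lemma dV1_mulrn_exp2 i n : D i n *+ 2 ^ i = 0.
Proof.
elim: i n => [|i IHi] n; first exact: dV10.
case: n => [|n]; first exact: wc_obj0.
by rewrite expnS mulrnA -V_dV1 -raddfMn IHi raddf0.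
Qed.

(** Substituting [-1] = -1 + V(1) in d[-1] [-1] gives -dV(1) + V(1) dV(1), where 2 dV(1) = 0 and
    V(1) dV(1) = V(FdV(1)). *)
Lemma dlogN1S n : dlogN1 n.+1 = D 1 n.+1 + V n (dlogN1 n).
Proof.
rewrite {1}/dlogN1 /wc_iota mulr1 teichN1 rmorphD rmorphN rmorph1 -V1_lam.
rewrite raddfD raddfN /= wc_d1 oppr0 add0r -/(D 1 n.+1).
rewrite mulrDr mulrN1; congr (_ + _).
  by apply/eqP; rewrite eq_sym -addr_eq0 -mulr2n (dV1_mulrn_exp2 1).
rewrite -(wc_comm0 (V1_deg 1 n.+1) (dV1_deg 1 n.+1)) V1S V10 V1M.
by rewrite -[D 1 n.+1]/(d n.+1 (V n ('V1 0 n))) V10 F_dV1.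
Qed.

Lemma dlogN1_sum n : dlogN1 n = \sum_(1 <= s < n) D s n *+ 2 ^ s.-1.
Proof.
elim: n => [|n IHn]; first by rewrite big_geq //; apply: wc_obj0.
rewrite dlogN1S IHn raddf_sum; case: n {IHn} => [|n].
  by rewrite !big_geq // dV1_ge // addr0.
rewrite [RHS]big_ltn // expn0 mulr1n; congr (_ + _).
rewrite [RHS]big_add1 /=; apply: eq_big_nat => -[|s] //= _.
by rewrite raddfMn /= V_dV1 -mulrnA -expnS.
Qed.

(** Multiplication by dlog[-1] commutes with V, so this is V^i of dlog[-1] from i levels below. *)
Lemma dlogN1_V1 i n :
  dlogN1 n * 'V1 i n = \sum_(i.+1 <= s < n) D s n *+ 2 ^ s.-1.
Proof.
elim: i n => [|i IHi] n; first by rewrite V10 mulr1 dlogN1_sum.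
case: n => [|n]; first by rewrite big_geq // mulr0.
rewrite V1S -V_dlogN1 IHi raddf_sum [RHS]big_add1 /=.
apply: eq_big_nat => -[|s] //= _.
by rewrite raddfMn /= V_dV1 -mulrnA -expnS.
Qed.

Lemma F_V1 i n : F n ('V1 i.+1 n.+1) = 'V1 i n *+ 2.
Proof. exact: wc_FV. Qed.

Lemma F_dV1S i n : F n (D i.+1 n.+1) = D i n + dlogN1 n * 'V1 i n.
Proof. by rewrite [LHS]wc_FdV wc_iotaE. Qed.

Lemma V1_mul i j n : (i <= j)%N -> 'V1 i n * 'V1 j n = 'V1 j n *+ 2 ^ i.
Proof.
elim: i j n => [|i IHi] j n leij; first by rewrite V10 mul1r.
case: j n leij => // j [|n] // leij; first by rewrite mul0r mul0rn.
rewrite V1S [LHS]wc_VM F_V1 mulrnAr IHi // V1S.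
by rewrite -mulrnA -expnSr raddfMn.
Qed.

(** The product of the two V's is an even multiple of one of them. *)
Lemma V1_mul_dlogN1 i j n : (0 < i)%N -> (0 < j)%N ->
  'V1 i n * 'V1 j n * dlogN1 n = 0.
Proof.
have H k l : (0 < k <= l)%N -> 'V1 k n * 'V1 l n * dlogN1 n = 0.
  case/andP=> k_gt0 lekl; rewrite V1_mul // mulrnAl -mulrnAr -(prednK k_gt0).
  by rewrite expnS mulrnA dlogN1_double mul0rn mulr0.
move=> i0 j0; case: (leqP i j) => [le | /ltnW le]; first by rewrite H ?i0.
by rewrite (wc_comm0 (V1_deg _ _) (V1_deg _ _)) H ?j0.
Qed.

(** By V(x) y = V(x F(y)) the product comes from V^(i-1)(1) (dV^(j-1)(1) + dlog[-1] V^(j-1)(1)) one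
    level below, and there the second summand contributes only for i = 1 or j = 1. The [if] and
    [maxn] join both cases of the product table, so that one induction proves them. *)
Lemma V1_mul_dV1 i j n : (0 < i)%N -> (0 < j)%N ->
  'V1 i n * D j n
  = D j n *+ (if (i < j)%N then 2 ^ i else 0)%N + dlogN1 n * 'V1 (maxn i j) n.
Proof.
case: i => // i; case: j => // j _ _.
elim: i j n => [|i IHi] j [|n]; try by rewrite [LHS]wc_obj0 [RHS]wc_obj0.
  rewrite V1S V10 V1M F_dV1S raddfD /= V_dV1 V_dlogN1 maxnSS max0n -V1S.
  (* For V(1) dV(1) the term 2 dV(1) is zero, in agreement with the coefficient 0. *)
  by congr (_ + _); case: j => [|j]; rewrite // (dV1_mulrn_exp2 1).
rewrite (V1S i.+1) [LHS]wc_VM F_dV1S mulrDr.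
rewrite dlogN1_comm mulrA; case: j => [|j].
  rewrite V10 mulr1 dV10 mulr0 add0r -dlogN1_comm V_dlogN1.
  by rewrite mulr0n add0r.
rewrite V1_mul_dlogN1 // addr0 IHi raddfD /= raddfMn /= V_dV1 V_dlogN1.
rewrite maxnSS -V1S -mulrnA -!maxnSS; congr (_ *+ _ + _).
by rewrite !ltnS; case: ifP => // _; rewrite (expnS 2 i.+1).
Qed.

(* Induction on the level: V^i(1) dV^j(1) dlog[-1] comes by V from the level
   below, and ddV^j(1) = dlog[-1] dV^j(1) = dV(1) dV^j(1) is killed by 2, so that
   applying d to the formula for V^i(1) dV^j(1), i <= j, leaves only the term
   dV^i(1) dV^j(1). *)
Lemma dV1_mul i j n : D i n * D j n = 0.
Proof.
elim: n i j => [|n IHn] i j; first exact: wc_obj0.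
have eta_D k : dlogN1 n * D k n = 0.
  rewrite dlogN1_sum mulr_suml big1 // => s _.
  by rewrite mulrnAl IHn mul0rn.
have etaeta m : dlogN1 n * dlogN1 n * m = 0.
  rewrite [X in X * _ * _]dlogN1_sum !mulr_suml big1 // => s _.
  by rewrite !mulrnAl -dlogN1_comm eta_D mul0r mul0rn.
have eta_D1 l : dlogN1 n.+1 * D l.+1 n.+1 = D 1 n.+1 * D l.+1 n.+1.
  rewrite dlogN1S mulrDl [X in _ + X]wc_VM F_dV1S mulrDr eta_D add0r.
  by rewrite mulrA etaeta raddf0 addr0.
have dD k : d n.+1 (D k n.+1) = dlogN1 n.+1 * D k n.+1.
  by rewrite [LHS]wc_dd wc_d_iota wc_iotaE.
have V1etaD k l : 'V1 k.+1 n.+1 * (dlogN1 n.+1 * D l.+1 n.+1) = 0.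
  rewrite [LHS]wc_VM rmorphM /= F_dlogN1 F_dV1S.
  by rewrite mulrDr eta_D add0r [dlogN1 n * (_ * _)]mulrA etaeta mulr0 raddf0.
have D1_2 l k : D 1 n.+1 * D l n.+1 *+ 2 ^ k.+1 = 0.
  by rewrite expnS mulrnA -mulrnAl (dV1_mulrn_exp2 1) mul0r mul0rn.
have dsum k : d n.+1 (dlogN1 n.+1 * 'V1 k.+1 n.+1) = 0.
  rewrite dlogN1_V1 raddf_sum big_nat big1 // => -[|[|s]] //= _.
  by rewrite raddfMn /= dD eta_D1 D1_2.
have H k l : (k <= l)%N -> D k.+1 n.+1 * D l.+1 n.+1 = 0.
  move=> lekl; have := V1_mul_dV1 n.+1 (ltn0Sn k) (ltn0Sn l).
  rewrite maxnSS (maxn_idPr lekl) => /(congr1 (d n.+1)).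
  rewrite wc_dM0; last exact: V1_deg.
  rewrite raddfD /= dsum addr0 dD V1etaD addr0 raddfMn /= dD eta_D1 => ->.
  by case: ifP => // _; rewrite D1_2.
case: i j => [|i] [|j]; rewrite ?dV10 ?mul0r ?mulr0 //.
case: (leqP i j) => [|/ltnW]; first exact: H.
rewrite (gr_comm (wc_graded E n.+1) (dV1_deg _ _) (dV1_deg _ _)) => /H ->.
by rewrite mulr0.
Qed.

Lemma d_dV1 i n : d n (D i n) = 0.
Proof.
rewrite [LHS]wc_dd wc_d_iota wc_iotaE -/(D i n) dlogN1_sum mulr_suml big1 // => s _.
by rewrite mulrnAl dV1_mul mul0rn.
Qed.

Lemma R_V1 i n : R n ('V1 i n.+1) = 'V1 i n.
Proof.
elim: i n => [|i IHi] n; first by rewrite !V10 rmorph1.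
case: n => [|n]; last by rewrite V1S [LHS]wc_VR IHi.
by rewrite [LHS]wc_obj0 V1_ge.
Qed.

Lemma R_dV1 i n : R n (D i n.+1) = D i n.
Proof. by rewrite [LHS]wc_dR R_V1. Qed.

End WittComplexTheory.

(** * The model of the de Rham-Witt complex *)

(* The degree 1 part: the coordinate of index t is the coefficient of
   dV^(t+1)(1). *)
Definition om n : Type := {dffun forall i : 'I_n.-1, Zt i}.
HB.instance Definition _ n := Choice.on (om n).

(** Lifts all coordinates to the one ring Z_(2), where those of different moduli can be combined;
    the value 0 outside the range allows indices in [nat]. *)
HB.lock Definition omlift n (m : om n) (t : nat) : Z2loc :=
  if insub t is Some i then (m i : nat)%:R else 0.

Section OmZmod.
Variable n : nat.
Implicit Types m : om n.

Definition omadd m m' : om n := [ffun i => m i + m' i].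
Definition omopp m : om n := [ffun i => - m i].
Definition omzero : om n := [ffun i => 0].

Fact omaddA : associative omadd.
Proof. by move=> m m' m''; apply/ffunP => i; rewrite !ffunE addrA. Qed.
Fact omaddC : commutative omadd.
Proof. by move=> m m'; apply/ffunP => i; rewrite !ffunE addrC. Qed.
Fact omadd0 : left_id omzero omadd.
Proof. by move=> m; apply/ffunP => i; rewrite !ffunE add0r. Qed.
Fact omaddN : left_inverse omzero omopp omadd.
Proof. by move=> m; apply/ffunP => i; rewrite !ffunE addNr. Qed.
HB.instance Definition _ :=
  GRing.isZmodule.Build (om n) omaddA omaddC omadd0 omaddN.

Definition omk (f : nat -> Z2loc) : om n := [ffun i : 'I_n.-1 => redZ i (f i)].
Lemma redZ_olift m (i : 'I_n.-1) : redZ i (omlift m i) = m i.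
Proof. by rewrite omlift.unlock valK redZ_val. Qed.

Lemma omlift_omk f t : (t < n.-1)%N -> redZ t (omlift (omk f) t) = redZ t (f t).
Proof. by move=> lt; apply: etrans (redZ_olift _ (Ordinal lt)) _; rewrite ffunE. Qed.

Lemma om_ext m m' :
  (forall t, (t < n.-1)%N -> redZ t (omlift m t) = redZ t (omlift m' t)) -> m = m'.
Proof. by move=> E; apply/ffunP => i; rewrite -!redZ_olift E. Qed.

Lemma omliftD m m' t : (t < n.-1)%N ->
  redZ t (omlift (m + m') t) = redZ t (omlift m t + omlift m' t).
Proof.
move=> lt; apply: etrans (redZ_olift _ (Ordinal lt)) _.
rewrite [X in X = _]ffunE rmorphD /=.
by congr (_ + _); apply/esym/(redZ_olift _ (Ordinal lt)).
Qed.

Lemma omlift0 t : redZ t (omlift 0 t) = 0.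
Proof.
rewrite omlift.unlock; case: insubP => [i _ <-|_]; last exact: rmorph0.
by rewrite redZ_val; apply: ffunE.
Qed.

End OmZmod.

Definition osum n t (m : om n) : Z2loc := \sum_(j < t) omlift m j.

Lemma redZ0 t a b : redZ t a = redZ t b -> redZ 0 a = redZ 0 b.
Proof. by move/redZ_dvd1=> ab; apply/eqP; rewrite redZ_eq. Qed.

(** The form in which the identities of the model are checked: a main term modulo 2^(t+1) and a
    correction 2^t b of which only the parity of b counts. *)
Lemma redZ_cong t a a' b b' : redZ t a = redZ t a' -> redZ 0 b = redZ 0 b' ->
  redZ t (a + 2 ^+ t * b) = redZ t (a' + 2 ^+ t * b').
Proof.
move=> Ea Eb; rewrite !rmorphD /= Ea; congr (_ + _).
by apply: redZ_parity; apply: (@redZ_dvd1 0).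
Qed.

Lemma redZ_mull t c a a' : redZ t a = redZ t a' -> redZ t (c * a) = redZ t (c * a').
Proof. by move=> E; rewrite !rmorphM /= E. Qed.

Lemma redZ0_exp2 t a : redZ 0 (2 ^+ t.+1 * a) = 0.
Proof. by rewrite exprS -mulrA rmorphM /= (redZ_exp2 0) mul0r. Qed.

Lemma redZ0_ghost n k (x : witt Z2loc n) : redZ 0 (ghost k x) = redZ 0 (ghost 0 x).
Proof. by apply/eqP; rewrite redZ_eq ghost_parity. Qed.

Lemma redZ0_wparM n k (x y : witt Z2loc n) : (k < n)%N ->
  redZ 0 (wpar k (x * y)) = redZ 0 (ghost 0 x * wpar k y + wpar k x * ghost 0 y).
Proof. by move=> ltkn; apply/eqP; rewrite redZ_eq wparM. Qed.

Lemma osum_cong n t (m : om n) f :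
  (forall j, (j < t)%N -> redZ 0 (omlift m j) = redZ 0 (f j)) ->
  redZ 0 (osum t m) = redZ 0 (\sum_(j < t) f j).
Proof. by move=> E; rewrite !rmorph_sum; apply: eq_bigr => j _; apply: E. Qed.

Lemma osum_omk n t f : (t <= n.-1)%N ->
  redZ 0 (osum t (omk n f)) = redZ 0 (\sum_(j < t) f j).
Proof.
move=> letn; apply: osum_cong => j ltjt; apply: (@redZ0 j).
by rewrite omlift_omk // (leq_trans ltjt).
Qed.

Lemma osumD n t (m m' : om n) : (t <= n.-1)%N ->
  redZ 0 (osum t (m + m')) = redZ 0 (osum t m + osum t m').
Proof.
move=> letn; have -> : osum t m + osum t m' = \sum_(j < t) (omlift m j + omlift m' j).
  by rewrite big_split.
apply: (osum_cong (f := fun j => omlift m j + omlift m' j)) => j ltjt.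
by apply: (@redZ0 j); rewrite omliftD // (leq_trans ltjt).
Qed.

Lemma osum0 n t : redZ 0 (osum t (0 : om n)) = 0.
Proof.
rewrite rmorph_sum big1 // => j _ /=.
by rewrite -(rmorph0 (redZ 0)); apply: (@redZ0 j); rewrite omlift0 rmorph0.
Qed.

Lemma ltn_pred_lt n t : (t < n.-1)%N -> (t < n)%N.
Proof. by case: n => // n /ltnW. Qed.

(* For j >= 1, V^i(1) dV^j(1) has the coefficient w_(j-1)(V^i(1)) on dV^j(1), with
   w the ghost map, and 2^(s-1) on dV^s(1) for s > j, provided 1 <= i < s; this is
   the extension of these products by linearity. *)
HB.lock Definition oact n (x : witt Z2loc n) (m : om n) : om n :=
  omk n (fun t => ghost t x * omlift m t + 2 ^+ t * (wpar t x * osum t m)).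

Section OmModule.
Variable n : nat.
Implicit Types (m : om n) (x y : witt Z2loc n).

Lemma omlift_oact x m t : (t < n.-1)%N -> redZ t (omlift (oact x m) t)
  = redZ t (ghost t x * omlift m t + 2 ^+ t * (wpar t x * osum t m)).
Proof. by move=> lt; rewrite oact.unlock omlift_omk. Qed.

Lemma osum_oact t x m : (t <= n.-1)%N ->
  redZ 0 (osum t (oact x m)) = redZ 0 (ghost 0 x * osum t m).
Proof.
move=> letn; rewrite oact.unlock osum_omk // mulr_sumr !rmorph_sum.
apply: eq_bigr => j _ /=; rewrite rmorphD !rmorphM /= redZ0_ghost.
rewrite -!rmorphM -[RHS]addr0; congr (_ + _).
(* The correction is even for j > 0, and for j = 0 it contains an empty sum. *)
case: (nat_of_ord j) => [|k]; last exact: redZ0_exp2.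
by rewrite /wpar big_ord0 mul0r mulr0 rmorph0.
Qed.

Fact oactDr x m m' : oact x (m + m') = oact x m + oact x m'.
Proof.
apply: om_ext => t ltt; rewrite [RHS]omliftD // rmorphD /= !omlift_oact //.
rewrite -rmorphD /=.
set g := ghost _ _; set p := wpar _ _.
have -> : g * omlift m t + 2 ^+ t * (p * osum t m) +
   (g * omlift m' t + 2 ^+ t * (p * osum t m')) =
   g * (omlift m t + omlift m' t) + 2 ^+ t * (p * (osum t m + osum t m')) by ring.
by apply: redZ_cong; apply: redZ_mull; rewrite ?omliftD ?osumD // ltnW.
Qed.

Fact oactDl x y m : oact (x + y) m = oact x m + oact y m.
Proof.
apply: om_ext => t ltt; rewrite [RHS]omliftD // rmorphD /= !omlift_oact //.
rewrite -rmorphD /=; have ltn := ltn_pred_lt ltt.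
by rewrite ghostD // wparD //; congr (redZ t _); ring.
Qed.

Fact oact1 m : oact 1 m = m.
Proof.
apply: om_ext => t ltt; have ltn := ltn_pred_lt ltt.
by rewrite omlift_oact // ghost1 // wpar1 // mul1r mul0r mulr0 addr0.
Qed.

(** The main terms agree as ghost components are multiplicative, the corrections by the Leibniz rule
    modulo 2 for [wpar]. *)
Fact oactA x y m : oact x (oact y m) = oact (x * y) m.
Proof.
apply: om_ext => t ltt; have ltn := ltn_pred_lt ltt.
rewrite !omlift_oact // ghostM //.
rewrite rmorphD /= (redZ_mull _ (omlift_oact _ _ ltt)) -rmorphD /=.
set os := osum t (oact y m).
have -> : ghost t x * (ghost t y * omlift m t + 2 ^+ t * (wpar t y * osum t m))
    + 2 ^+ t * (wpar t x * os)
  = ghost t x * ghost t y * omlift m t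
    + 2 ^+ t * (ghost t x * (wpar t y * osum t m) + wpar t x * os) by ring.
apply: redZ_cong => //; rewrite {}/os.
rewrite [RHS]rmorphM /= redZ0_wparM //.
rewrite rmorphD [X in _ + X]rmorphM /= osum_oact 1?ltnW //.
by rewrite -!rmorphM -rmorphD /= !rmorphD !rmorphM /= (redZ0_ghost t); ring.
Qed.

Lemma oact0r x : oact x 0 = 0.
Proof. by apply: (addrI (oact x 0)); rewrite -oactDr !addr0. Qed.
Lemma oact0l m : oact 0 m = 0.
Proof. by apply: (addrI (oact 0 m)); rewrite -oactDl !addr0. Qed.

Definition drw : Type := (witt Z2loc n * om n)%type.
HB.instance Definition _ := GRing.Zmodule.copy drw (witt Z2loc n * om n)%type.

Implicit Types u v w : drw.
Definition drw_one : drw := (1, 0).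
Definition drw_mul u v : drw := (u.1 * v.1, oact u.1 v.2 + oact v.1 u.2).

Lemma drw_eq u v : u.1 = v.1 -> u.2 = v.2 -> u = v.
Proof. by case: u v => [x m] [y k] /= -> ->. Qed.

Fact drw_mulA : associative drw_mul.
Proof.
move=> u v w; apply: drw_eq => /=; first exact: mulrA.
by rewrite !oactDr !oactA addrA (mulrC w.1 u.1) (mulrC w.1 v.1).
Qed.
Fact drw_mulC : commutative drw_mul.
Proof. by move=> u v; apply: drw_eq; [apply: mulrC | apply: addrC]. Qed.
Fact drw_mul1 : left_id drw_one drw_mul.
Proof.
move=> u; apply: drw_eq => /=; first exact: mul1r.
by rewrite oact1 oact0r addr0.
Qed.
Fact drw_mulDl : left_distributive drw_mul (@GRing.add drw).
Proof.
move=> u v w; apply: drw_eq => /=; first exact: mulrDl.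
by rewrite oactDl oactDr addrACA.
Qed.
HB.instance Definition _ :=
  GRing.Zmodule_isComPzRing.Build drw drw_mulA drw_mulC drw_mul1 drw_mulDl.

Lemma drw_mulE u v : u * v = (u.1 * v.1, oact u.1 v.2 + oact v.1 u.2).
Proof. by []. Qed.
End OmModule.

(** * The operators R, F, V and d in degree 1 of the model *)

Section OmOperators.
Variable n : nat.

Definition omR (m : om n.+1) : om n := omk n (omlift m).
(** Read off from F(dV^i(1)): dV^(t+1)(1) occurs once from the shift of dV^(t+2)(1), and with
    coefficient 2^t in F(dV^i(1)) for each i <= t+1, that is, from the indices j < t+1. *)
Definition omF (m : om n.+1) : om n :=
  omk n (fun t => omlift m t.+1 + 2 ^+ t * osum t.+1 m).
Definition omV (m : om n) : om n.+1 :=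
  omk n.+1 (fun t => if t is s.+1 then 2 * omlift m s else 0).
Definition omd (x : witt Z2loc n) : om n := omk n (fun t => wcoef x t.+1).

Lemma omlift_R m t : (t < n.-1)%N -> redZ t (omlift (omR m) t) = redZ t (omlift m t).
Proof. exact: omlift_omk. Qed.

Lemma omlift_F m t : (t < n.-1)%N ->
  redZ t (omlift (omF m) t) = redZ t (omlift m t.+1 + 2 ^+ t * osum t.+1 m).
Proof. exact: omlift_omk. Qed.

Lemma omlift_V0 m : (0 < n)%N -> redZ 0 (omlift (omV m) 0) = 0.
Proof. by move=> n0; rewrite omlift_omk // rmorph0. Qed.

Lemma omlift_VS m t : (t.+1 < n)%N ->
  redZ t.+1 (omlift (omV m) t.+1) = redZ t.+1 (2 * omlift m t).
Proof. by move=> ltt; rewrite /omV omlift_omk. Qed.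

Lemma omlift_d x t : (t < n.-1)%N -> redZ t (omlift (omd x) t) = redZ t (wcoef x t.+1).
Proof. exact: omlift_omk. Qed.

Lemma osum_R t m : (t <= n.-1)%N -> redZ 0 (osum t (omR m)) = redZ 0 (osum t m).
Proof. exact: osum_omk. Qed.

Lemma osum_d t x : (t <= n.-1)%N -> redZ 0 (osum t (omd x)) = redZ 0 (wpar t x).
Proof. exact: osum_omk. Qed.

Lemma osum_V t m : (t <= n)%N -> redZ 0 (osum t (omV m)) = 0.
Proof.
move=> letn; rewrite osum_omk // rmorph_sum big1 // => -[[|j] ltjt] _ /=.
  exact: rmorph0.
by rewrite -[2]expr1 redZ0_exp2.
Qed.

(** F shifts the coordinates down by one, but the lowest is not lost modulo 2: the correction has
    factor 2^0 at index 0, so F(m) starts with m_1 + m_0. *)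
Lemma osum_F t m : (t.+1 < n)%N ->
  redZ 0 (osum t.+1 (omF m)) = redZ 0 (osum t.+2 m).
Proof.
move=> ltn; rewrite osum_omk ?ltn_predRL // /osum !big_ord_recl /=.
rewrite mul1r big_ord0 addr0 !rmorphD /= !rmorph_sum [RHS]addrA.
rewrite [X in _ = X + _]addrC; congr (_ + _); apply: eq_bigr => i _ /=.
by rewrite rmorphD /= redZ0_exp2 addr0.
Qed.

Fact omR_nmod : nmod_morphism omR.
Proof.
split=> [|m m']; apply: om_ext => t ltt; have ltn := ltn_pred_lt ltt.
  by rewrite omlift_R // !omlift0.
rewrite omlift_R // [LHS]omliftD // [RHS]omliftD //.
by rewrite !rmorphD /= !omlift_R.
Qed.

Fact omF_nmod : nmod_morphism omF.
Proof.
split=> [|m m']; apply: om_ext => t ltt; have ltn := ltn_pred_lt ltt.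
  rewrite omlift_F // omlift0; transitivity (redZ t (0 + 2 ^+ t * 0)); last first.
    by rewrite mulr0 addr0 rmorph0.
  apply: redZ_cong; last by rewrite osum0 rmorph0.
  by apply: redZW; rewrite omlift0 rmorph0.
rewrite omlift_F // [RHS]omliftD // [RHS]rmorphD /= !omlift_F // -rmorphD /=.
rewrite addrACA -mulrDr; apply: redZ_cong; last exact: osumD.
by apply: redZW; rewrite omliftD //; case: n ltt.
Qed.

Fact omV_nmod : nmod_morphism omV.
Proof.
split=> [|m m']; apply: om_ext => -[|t] ltt.
- by rewrite omlift_V0 // omlift0.
- rewrite omlift_VS // omlift0 -(rmorph0 (redZ _)) -(mulr0 2).
  by apply: redZ_double; rewrite omlift0 rmorph0.
- by rewrite [RHS]omliftD // [RHS]rmorphD /= !omlift_V0 // addr0.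
rewrite [RHS]omliftD // [RHS]rmorphD /= !omlift_VS // -rmorphD -mulrDr.
by apply: redZ_double; rewrite omliftD // ltn_predRL.
Qed.

Fact omd_nmod : nmod_morphism omd.
Proof.
split=> [|x y]; apply: om_ext => t ltt; have ltn : (t.+1 < n)%N by rewrite -ltn_predRL.
  by rewrite omlift_d // omlift0 wcoef0 // rmorph0.
by rewrite [RHS]omliftD // [RHS]rmorphD /= !omlift_d // wcoefD // rmorphD.
Qed.

HB.instance Definition _ := GRing.isNmodMorphism.Build (om n.+1) (om n) omR omR_nmod.
HB.instance Definition _ := GRing.isNmodMorphism.Build (om n.+1) (om n) omF omF_nmod.
HB.instance Definition _ := GRing.isNmodMorphism.Build (om n) (om n.+1) omV omV_nmod.
HB.instance Definition _ :=
  GRing.isNmodMorphism.Build (witt Z2loc n) (om n) omd omd_nmod.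

Lemma omR_act x m : omR (oact x m) = oact (wittR x) (omR m).
Proof.
apply: om_ext => t ltt; have ltn := ltn_pred_lt ltt.
rewrite omlift_R // !omlift_oact // ghost_wittR //.
have -> : wpar t (wittR x) = wpar t x.
  apply: eq_bigr => i _; rewrite wcoef_R // (leq_ltn_trans (ltn_ord i) ltn) //.
apply: redZ_cong; apply: redZ_mull; rewrite ?omlift_R // osum_R //.
exact: ltnW.
Qed.

Lemma redZ0_wpar_F t (x : witt Z2loc n.+1) : (t < n)%N -> redZ 0 (wpar t (wittF x)) = 0.
Proof.
move=> ltn; rewrite rmorph_sum big1 // => i _ /=.
rewrite wcoef_F; last exact: leq_ltn_trans (ltn_ord i) ltn.
by rewrite -[2]expr1 redZ0_exp2.
Qed.

(** Both action corrections vanish: the one of x at index t+1 carries 2^(t+1), which is zero at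
    index t, and [wpar] of F(x) is even. *)
Lemma omF_act x m : omF (oact x m) = oact (wittF x) (omF m).
Proof.
apply: om_ext => t ltt; have ltn := ltn_pred_lt ltt.
have ltn1 : (t.+1 < n)%N by rewrite -ltn_predRL.
rewrite omlift_F // omlift_oact // wittF_ghost //.
transitivity (redZ t (ghost t.+1 x * omlift m t.+1 + 2 ^+ t * (ghost 0 x * osum t.+1 m))).
  apply: redZ_cong; last by rewrite osum_oact.
  apply: etrans (redZW (omlift_oact x m ltn1)) _.
  by rewrite rmorphD /= [X in _ + X]rmorphM /= redZ_exp2 mul0r addr0.
transitivity (redZ t
  (ghost t.+1 x * (omlift m t.+1 + 2 ^+ t * osum t.+1 m) + 2 ^+ t * 0)).
  rewrite mulr0 addr0 mulrDr [_ * (2 ^+ t * _)]mulrCA; apply: redZ_cong => //.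
  by rewrite !rmorphM /= (redZ0_ghost t.+1).
apply: redZ_cong; first by apply: redZ_mull; rewrite omlift_F.
by rewrite rmorphM /= redZ0_wpar_F // mul0r rmorph0.
Qed.

(** No correction survives, as V(m) has even coordinates and [wpar] of F(y) is even. *)
Lemma omV_act m (y : witt Z2loc n.+1) : oact y (omV m) = omV (oact (wittF y) m).
Proof.
apply: om_ext => t ltt; rewrite omlift_oact //.
transitivity (redZ t (ghost t y * omlift (omV m) t + 2 ^+ t * 0)).
  by apply: redZ_cong => //; rewrite rmorphM /= osum_V 1?ltnW // mulr0 rmorph0.
rewrite mulr0 addr0; case: t ltt => [|t] ltt.
  by rewrite rmorphM /= !omlift_V0 // mulr0.
rewrite omlift_VS // rmorphM /= omlift_VS // -rmorphM mulrCA.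
apply: redZ_double; rewrite omlift_oact ?ltn_predRL // wittF_ghost 1?ltnW //.
rewrite -[LHS]addr0 -(rmorph0 (redZ t)) -(mulr0 (2 ^+ t)) -rmorphD.
apply: redZ_cong => //.
by rewrite rmorphM /= redZ0_wpar_F ?mul0r ?rmorph0 // ltnW.
Qed.

Lemma wparS_V t (x : witt Z2loc n) : wpar t.+1 (wittV x) = wcoef x 0 + wpar t x.
Proof.
rewrite /wpar big_ord_recl wcoef_VS; congr (_ + _).
by apply: eq_bigr => i _; rewrite wcoef_VS.
Qed.

(** Passing from x to V(x) adds the coefficient x_0 to [wpar]; as x_0 has the parity of every ghost
    component of x, it accounts for the correction in F. *)
Lemma wittV_act (x : witt Z2loc n) (m : om n.+1) :
  oact (wittV x) m = omV (oact x (omF m)).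
Proof.
apply: om_ext => -[|t] ltt; rewrite omlift_oact //.
  by rewrite ghost_wittV0 mul0r add0r /wpar big_ord0 mul0r mulr0 rmorph0 omlift_V0.
have ltt' : (t < n.-1)%N by rewrite ltn_predRL.
rewrite omlift_VS // ghost_wittVS wparS_V.
set os := osum t.+1 m.
have -> : ghost t x *+ 2 * omlift m t.+1 + 2 ^+ t.+1 * ((wcoef x 0 + wpar t x) * os)
  = 2 * (ghost t x * omlift m t.+1 + 2 ^+ t * ((wcoef x 0 + wpar t x) * os)).
  by rewrite exprS; ring.
rewrite {}/os; apply: redZ_double; rewrite omlift_oact //.
transitivity (redZ t (ghost t x * (omlift m t.+1 + 2 ^+ t * osum t.+1 m)
    + 2 ^+ t * (wpar t x * osum t.+1 m))).
  set os := osum t.+1 m.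
  have -> : ghost t x * (omlift m t.+1 + 2 ^+ t * os) + 2 ^+ t * (wpar t x * os)
    = ghost t x * omlift m t.+1 + 2 ^+ t * ((ghost t x + wpar t x) * os) by ring.
  apply: redZ_cong => //.
  by rewrite !rmorphM !rmorphD /= (redZ0_ghost t).
apply: redZ_cong; first by apply: redZ_mull; rewrite omlift_F.
(* [osum_F] starts at t = 1; for t = 0 the factor [wpar] is an empty sum. *)
case: t ltt ltt' => [|t] ltt ltt'; first by rewrite /wpar big_ord0 !mul0r.
by rewrite !rmorphM /= osum_F // ltnW.
Qed.

Lemma omFV m : omF (omV m) = m *+ 2.
Proof.
apply: om_ext => t ltt; have ltn := ltn_pred_lt ltt; rewrite omlift_F //.
rewrite mulr2n omliftD //.
transitivity (redZ t (2 * omlift m t + 2 ^+ t * 0)).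
  apply: redZ_cong; last by rewrite osum_V // rmorph0.
  by apply: redZW; rewrite omlift_VS // -ltn_predRL.
by rewrite mulr0 addr0 mulr_natl mulr2n.
Qed.

(** The two corrections are equal and add up to a multiple of 2^(t+1); so is the last term of
    [wcoefM]. *)
Lemma omdM x y : omd (x * y) = oact x (omd y) + oact y (omd x).
Proof.
apply: om_ext => t ltt; have ltn := ltn_pred_lt ltt.
have ltn1 : (t.+1 < n)%N by rewrite -ltn_predRL.
have H z w : redZ t (ghost t z * omlift (omd w) t + 2 ^+ t * (wpar t z * osum t (omd w)))
    = redZ t (ghost t z * wcoef w t.+1 + 2 ^+ t * (wpar t z * wpar t w)).
  by apply: redZ_cong; apply: redZ_mull; rewrite ?omlift_d // osum_d // ltnW.
rewrite omlift_d // [RHS]omliftD // [RHS]rmorphD /= !omlift_oact // !H -rmorphD.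
have -> : ghost t x * wcoef y t.+1 + 2 ^+ t * (wpar t x * wpar t y) +
    (ghost t y * wcoef x t.+1 + 2 ^+ t * (wpar t y * wpar t x))
  = wcoef x t.+1 * ghost t y + ghost t x * wcoef y t.+1
    + 2 ^+ t.+1 * (wpar t x * wpar t y) by rewrite exprS; ring.
rewrite wcoefM // [LHS]rmorphD [RHS]rmorphD /=; congr (_ + _).
by rewrite !(rmorphM _ (2 ^+ t.+1)) /= redZ_exp2 !mul0r.
Qed.

End OmOperators.

Lemma omFR n (m : om n.+2) : omR (omF m) = omF (omR m).
Proof.
apply: om_ext => t ltt; have ltn := ltn_pred_lt ltt.
rewrite omlift_R // !omlift_F //; apply: redZ_cong; last by rewrite osum_R.
by apply: redZW; rewrite omlift_R // -ltn_predRL.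
Qed.

Lemma omVR n (m : om n.+1) : omR (omV m) = omV (omR m).
Proof.
apply: om_ext => -[|t] ltt; have ltn := ltn_pred_lt ltt; rewrite omlift_R //.
  by rewrite !omlift_V0.
by rewrite !omlift_VS //; apply: redZ_double; rewrite omlift_R // ltn_predRL.
Qed.

Lemma omdR n (x : witt Z2loc n.+1) : omR (omd x) = omd (wittR x).
Proof.
apply: om_ext => t ltt; have ltn := ltn_pred_lt ltt.
by rewrite omlift_R // !omlift_d // wcoef_R // -ltn_predRL.
Qed.

Definition om_dlogN1 n : om n := omk n (fun t => 2 ^+ t).

Lemma om_dlogN1E n :
  oact (teich n (-1)) (omd (teich n (-1))) = om_dlogN1 n.
Proof.
case: n => [|n]; apply: om_ext => // t ltt.
(* The coefficients of [-1] = -1 + V(1). *)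
have c1 k : (k < n)%N -> wcoef (teich n.+1 (-1) : witt Z2loc n.+1) k.+1 = (k == 0)%:R.
  move=> ltk; apply: wcoefS; rewrite !ghost_teich // 1?ltnW //.
  case: k {ltk} => [|k]; first by rewrite /= expn0 expn1 !expr1; ring.
  have e j : (-1) ^+ (2 ^ j.+1) = 1 :> Z2loc by rewrite expnS exprM sqrrN !expr1n.
  by rewrite !e mulr0 addr0.
have p1 k : (k < n)%N -> wpar k.+1 (teich n.+1 (-1) : witt Z2loc n.+1) = 1.
  move=> ltk; rewrite /wpar big_ord_recl c1 ?(leq_ltn_trans _ ltk) //.
  rewrite big1 ?addr0 // => i _.
  by rewrite c1 //; apply: leq_ltn_trans (ltn_ord _) ltk.
rewrite omlift_oact // omlift_omk //; case: t ltt => [|t] ltt.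
  rewrite /osum big_ord0 !mulr0 addr0 rmorphM /= omlift_d // c1 // -rmorphM /=.
  rewrite ghost_teich // mulr1 expr1 expr0.
  by apply/eqP; rewrite redZ_eq; apply/dvd2P; exists (-1); ring.
transitivity (redZ t.+1 (0 + 2 ^+ t.+1 * 1)); last by rewrite add0r mulr1.
apply: redZ_cong; first by rewrite rmorphM /= omlift_d // c1 // rmorph0 mulr0.
by rewrite p1 1?ltnW // mul1r osum_d 1?ltnW // p1 // ltnW.
Qed.

Lemma omFdV n (x : witt Z2loc n) : omF (omd (wittV x)) = omd x + oact x (om_dlogN1 n).
Proof.
apply: om_ext => t ltt; have ltn := ltn_pred_lt ltt.
have ltn1 : (t.+1 < n)%N by rewrite -ltn_predRL.
rewrite omlift_F // [RHS]omliftD // [RHS]rmorphD /=.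
transitivity (redZ t (wcoef x t.+1 + 2 ^+ t * (wcoef x 0 + wpar t x))).
  apply: redZ_cong; last by rewrite osum_d // wparS_V.
  by apply: redZW; rewrite omlift_d // wcoef_VS.
rewrite [LHS]rmorphD /= omlift_d //; congr (_ + _); rewrite omlift_oact //.
transitivity (redZ t (2 ^+ t * (ghost t x + wpar t x))).
  apply: redZ_parity; apply: (@redZ_dvd1 0).
  by rewrite !rmorphD /= (redZ0_ghost t).
rewrite mulrDr [_ * ghost t x]mulrC; apply: redZ_cong.
  by rewrite !rmorphM /= omlift_omk.
(* The partial coordinate sums of dlog[-1] are odd from t = 1 on, only the coordinate 2^0 being odd;
   at t = 0 both sides are empty. *)
case: t ltt {ltn ltn1} => [|t] ltt; first by rewrite /wpar big_ord0 mul0r.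
have -> : redZ 0 (wpar t.+1 x * osum t.+1 (om_dlogN1 n)) = redZ 0 (wpar t.+1 x * 1).
  apply: redZ_mull; rewrite osum_omk 1?ltnW // big_ord_recl rmorphD /= rmorph_sum.
  by rewrite big1 ?addr0 // => i _ /=; rewrite -[_ ^+ _]mulr1 redZ0_exp2.
by rewrite mulr1.
Qed.

(** By [wcoef_teich] the left side has correction c^2 + c + [wpar] t, with c the coefficient of [a]
    on V^(t+1)(1), and the right side has the square of [wpar] t; these agree as b^2 = b modulo
    2. *)
Lemma omFd_teich n (a : Z2loc) :
  omF (omd (teich n.+1 a)) = oact (teich n a) (omd (teich n a)).
Proof.
apply: om_ext => t ltt; have ltn := ltn_pred_lt ltt.
have ltn1 : (t.+1 < n)%N by rewrite -ltn_predRL.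
have gR k : (k < n)%N -> ghost k (teich n.+1 a) = ghost k (teich n a).
  by move=> ltk; rewrite !ghost_teich // ltnW.
have tR k : (k < n)%N -> wcoef (teich n.+1 a) k = wcoef (teich n a) k.
  case: k => [|k] ltk; first exact: gR.
  by apply: wcoefS; rewrite !gR // 1?ltnW // -ghostS.
have pR : wpar t.+1 (teich n.+1 a) = wpar t.+1 (teich n a).
  by apply: eq_bigr => i _; rewrite tR //; apply: leq_ltn_trans (ltn_ord _) ltn1.
rewrite omlift_F // omlift_oact //.
set x := teich n a.
transitivity (redZ t (wcoef (teich n.+1 a) t.+2 + 2 ^+ t * wpar t.+1 x)).
  by apply: redZ_cong; [apply: redZW; rewrite omlift_d | rewrite osum_d // pR].
rewrite wcoef_teich // tR // -/x.
transitivity (redZ t (ghost t x * wcoef x t.+1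
  + 2 ^+ t * (wpar t x * wpar t x))); last first.
  by apply: redZ_cong; apply: redZ_mull; rewrite ?omlift_d // osum_d // ltnW.
rewrite gR // -/x.
rewrite -addrA -mulrDr [_ * ghost _ _]mulrC; apply: redZ_cong => //.
have sq (b : Z2loc) : redZ 0 (b * b) = redZ 0 b.
  by apply/eqP; rewrite redZ_eq -expr2 dvd2_sqr_sub.
rewrite wparS sq expr2 rmorphD /= sq rmorphD /= addrCA -rmorphD /=.
by rewrite -mulr2n -mulr_natl -[2]expr1 redZ0_exp2 addr0.
Qed.

(** * The model as a Witt complex *)

Section DrwMaps.
Variable n : nat.

Definition drwR (u : drw n.+1) : drw n := (wittR u.1, omR u.2).
Definition drwF (u : drw n.+1) : drw n := (wittF u.1, omF u.2).
Definition drwV (u : drw n) : drw n.+1 := (wittV u.1, omV u.2).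
Definition drwd (u : drw n) : drw n := (0, omd u.1).
Definition drwlam (x : witt Z2loc n) : drw n := (x, 0).

Fact drwR_nmod : nmod_morphism drwR.
Proof.
split=> [|u v]; apply: drw_eq; [apply: raddf0|apply: raddf0|apply: raddfD|apply: raddfD].
Qed.
Fact drwR_monoid : monoid_morphism drwR.
Proof.
split=> [|u v]; apply: drw_eq; [apply: rmorph1 | apply: raddf0 | apply: rmorphM |].
by rewrite /drwR !drw_mulE /= raddfD /= !omR_act.
Qed.
Fact drwF_nmod : nmod_morphism drwF.
Proof.
split=> [|u v]; apply: drw_eq; [apply: raddf0|apply: raddf0|apply: raddfD|apply: raddfD].
Qed.
Fact drwF_monoid : monoid_morphism drwF.
Proof.
split=> [|u v]; apply: drw_eq; [apply: rmorph1 | apply: raddf0 | apply: rmorphM |].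
by rewrite /drwF !drw_mulE /= raddfD /= !omF_act.
Qed.
Fact drwV_nmod : nmod_morphism drwV.
Proof.
split=> [|u v]; apply: drw_eq; [apply: raddf0|apply: raddf0|apply: raddfD|apply: raddfD].
Qed.
Fact drwd_nmod : nmod_morphism drwd.
Proof.
split=> [|u v]; apply: drw_eq => //; [apply: raddf0| |apply: raddfD].
by rewrite /= addr0.
Qed.
Fact drwlam_nmod : nmod_morphism drwlam.
Proof. by split=> [|u v]; apply: drw_eq => //=; rewrite addr0. Qed.
Fact drwlam_monoid : monoid_morphism drwlam.
Proof.
split=> [|u v]; apply: drw_eq => //=.
by rewrite !oact0r addr0.
Qed.

HB.instance Definition _ := GRing.isNmodMorphism.Build (drw n.+1) (drw n) drwR drwR_nmod.
HB.instance Definition _ :=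
  GRing.isMonoidMorphism.Build (drw n.+1) (drw n) drwR drwR_monoid.
HB.instance Definition _ := GRing.isNmodMorphism.Build (drw n.+1) (drw n) drwF drwF_nmod.
HB.instance Definition _ :=
  GRing.isMonoidMorphism.Build (drw n.+1) (drw n) drwF drwF_monoid.
HB.instance Definition _ := GRing.isNmodMorphism.Build (drw n) (drw n.+1) drwV drwV_nmod.
HB.instance Definition _ := GRing.isNmodMorphism.Build (drw n) (drw n) drwd drwd_nmod.
HB.instance Definition _ :=
  GRing.isNmodMorphism.Build (witt Z2loc n) (drw n) drwlam drwlam_nmod.
HB.instance Definition _ :=
  GRing.isMonoidMorphism.Build (witt Z2loc n) (drw n) drwlam drwlam_monoid.

Definition drw_deg (i : nat) (u : drw n) : Prop :=
  match i with
  | 0%N => u.2 = 0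
  | 1%N => u.1 = 0
  | _ => u = 0
  end.

Lemma drw_deg_sum (m : nat) (c : nat -> drw n) : (forall i, drw_deg i (c i)) ->
  \sum_(i < m) c i = ((if (0 < m)%N then (c 0%N).1 else 0),
                      (if (1 < m)%N then (c 1%N).2 else 0)).
Proof.
move=> dc; case: m => [|[|m]]; first by rewrite big_ord0.
  by rewrite big_ord1; apply: drw_eq => //=; apply: (dc 0%N).
rewrite 2!big_ord_recl big1 ?addr0 => [|i _]; last exact: (dc i.+2).
by apply: drw_eq => /=; rewrite ?(dc 0%N : _ = _) ?(dc 1%N : _ = _) ?addr0 ?add0r.
Qed.

Fact drw_graded : graded_commutative drw_deg.
Proof.
split.
- by case=> [|[|i]].
- move=> [|[|i]] u v /= du dv; last by rewrite du dv subrr.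
    by rewrite du dv subrr.
  by rewrite du dv subrr.
- by [].
- move=> [|[|i]] [|[|j]] u v du dv; rewrite ?addn0 ?add0n ?addn1 ?add1n;
    rewrite drw_mulE /drw_deg; move: du dv => /= du dv.
  + by rewrite /= du dv !oact0r addr0.
  + by rewrite /= dv mulr0.
  + by rewrite dv /=; apply: drw_eq; rewrite /= ?mulr0 ?oact0r ?oact0l ?addr0.
  + by rewrite /= du mul0r.
  + by rewrite /= du dv mul0r !oact0l addr0.
  + by rewrite dv /=; apply: drw_eq; rewrite /= ?mulr0 ?oact0r ?oact0l ?addr0.
  + by rewrite du; apply: drw_eq; rewrite /= ?mul0r ?oact0r ?oact0l ?addr0.
  + by rewrite du; apply: drw_eq; rewrite /= ?mul0r ?oact0r ?oact0l ?addr0.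
  + by rewrite du; apply: drw_eq; rewrite /= ?mul0r ?oact0r ?oact0l ?addr0.
- move=> [|[|i]] [|[|j]] u v du dv; rewrite ?mul0n ?muln0 ?mul1r; try exact: mulrC.
  (* The sign is nontrivial only between forms of degree 1, whose products vanish. *)
  + have uv0 (w w' : drw n) : w.1 = 0 -> w'.1 = 0 -> w * w' = 0.
      move=> w0 w'0; apply: drw_eq; rewrite drw_mulE /= w0 w'0 ?mul0r //.
      by rewrite !oact0l addr0.
    by rewrite (uv0 u v) // (uv0 v u) // mulr0.
  + by rewrite (dv : v = 0) mul0r !mulr0.
  + by rewrite (du : u = 0) mul0r !mulr0.
  + by rewrite (du : u = 0) mul0r !mulr0.
- move=> u; exists 2%N.
  exists (fun i => match i with 0%N => (u.1, 0) | 1%N => (0, u.2) | _ => 0 end).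
  split; first by case=> [|[|i]].
  by rewrite big_ord_recl big_ord1 /=; apply: drw_eq; rewrite /= ?addr0 ?add0r.
- move=> m c dc; rewrite drw_deg_sum // => -[E0 E1] [|[|i]] ltim; last exact: (dc i.+2).
    by apply: drw_eq; [rewrite ltim in E0 | apply: (dc 0%N)].
  by apply: drw_eq; [apply: (dc 1%N) | rewrite ltim in E1].
Qed.

End DrwMaps.

Section DrwIdentities.
Variable n : nat.

Lemma drw_iotaE (u : drw n) :
  drwd (drwlam (teich n (-1))) * drwlam (teich n (-1)) * u
  = (0, oact u.1 (om_dlogN1 n)) :> drw n.
Proof.
apply: drw_eq; rewrite !drw_mulE /= ?mul0r //.
by rewrite !oact0l !add0r om_dlogN1E.
Qed.

Lemma drwR_deg i (u : drw n.+1) : drw_deg i u -> drw_deg i (drwR u).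
Proof. by case: i => [|[|i]] /= du; rewrite /drwR du ?raddf0. Qed.
Lemma drwF_deg i (u : drw n.+1) : drw_deg i u -> drw_deg i (drwF u).
Proof. by case: i => [|[|i]] /= du; rewrite /drwF du ?raddf0. Qed.
Lemma drwV_deg i (u : drw n) : drw_deg i u -> drw_deg i (drwV u).
Proof. by case: i => [|[|i]] /= du; rewrite /drwV du ?raddf0. Qed.
Lemma drwd_deg i (u : drw n) : drw_deg i u -> drw_deg i.+1 (drwd u).
Proof. by case: i => [|[|i]] //= du; rewrite /drwd du ?raddf0. Qed.

Lemma drwVM (u : drw n) (v : drw n.+1) : drwV u * v = drwV (u * drwF v).
Proof.
apply: drw_eq; rewrite !drw_mulE /=; first exact: wittVM.
by rewrite wittV_act omV_act raddfD.
Qed.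

Lemma drwFV (u : drw n) : drwF (drwV u) = u *+ 2.
Proof. by apply: drw_eq; rewrite /= ?wittFV ?omFV mulr2n. Qed.

Lemma drwdM i (u v : drw n) : drw_deg i u ->
  drwd (u * v) = drwd u * v + (-1) ^+ i * (u * drwd v).
Proof.
case: i => [|[|i]] du.
- rewrite expr0 mul1r; apply: drw_eq; rewrite !drw_mulE /= ?mul0r ?mulr0 ?addr0 //.
  by rewrite !oact0l addr0 add0r omdM addrC.
- rewrite [u * drwd v](_ : _ = 0) ?mulr0 ?addr0; last first.
    by apply: drw_eq; rewrite drw_mulE /= ?mulr0 // (du : _ = _) !oact0l addr0.
  rewrite /drwd drw_mulE /= (du : _ = _) !mul0r raddf0; apply: drw_eq => /=.
    by rewrite mul0r.
  by rewrite oact0l oact0r addr0.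
by rewrite (du : u = 0) !mul0r mulr0 raddf0 mul0r addr0.
Qed.

End DrwIdentities.

Lemma drw0E (u : drw 0) : u = 0.
Proof. by apply: drw_eq; [apply: witt0E | apply/ffunP => -[]]. Qed.

Lemma drwFR n (u : drw n.+2) : drwR (drwF u) = drwF (drwR u).
Proof. by apply: drw_eq; [apply: wittFR | apply: omFR]. Qed.

Lemma drwVR n (u : drw n.+1) : drwR (drwV u) = drwV (drwR u).
Proof. by apply: drw_eq; [apply: wittVR | apply: omVR]. Qed.

Lemma drwdR n (u : drw n.+1) : drwR (drwd u) = drwd (drwR u).
Proof. by apply: drw_eq; [apply: raddf0 | apply: omdR]. Qed.

Lemma drwR_lam n (x : witt Z2loc n.+1) : drwR (drwlam x) = drwlam (wittR x).
Proof. by apply: drw_eq => //; apply: raddf0. Qed.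
Lemma drwF_lam n (x : witt Z2loc n.+1) : drwF (drwlam x) = drwlam (wittF x).
Proof. by apply: drw_eq => //; apply: raddf0. Qed.
Lemma drwV_lam n (x : witt Z2loc n) : drwV (drwlam x) = drwlam (wittV x).
Proof. by apply: drw_eq => //; apply: raddf0. Qed.

Lemma drwFdV n (u : drw n) : drwF (drwd (drwV u)) = drwd u +
  drwd (drwlam (teich n (-1))) * drwlam (teich n (-1)) * u.
Proof.
rewrite drw_iotaE; apply: drw_eq; last exact: omFdV.
by rewrite [LHS]raddf0 /= addr0.
Qed.

Lemma drwdd n (u : drw n) : drwd (drwd u) =
  drwd (drwd (drwlam (teich n (-1))) * drwlam (teich n (-1)) * u).
Proof. by rewrite drw_iotaE. Qed.

Lemma drwd_iota n (u : drw n) :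
  drwd (drwd (drwlam (teich n (-1))) * drwlam (teich n (-1)) * u) =
  drwd (drwlam (teich n (-1))) * drwlam (teich n (-1)) * drwd u.
Proof. by rewrite !drw_iotaE /drwd /= raddf0 oact0l. Qed.

Lemma drwFd_teich n (a : Z2loc) : drwF (drwd (drwlam (teich n.+1 a))) =
  drwlam (teich n a) * drwd (drwlam (teich n a)).
Proof.
apply: drw_eq; rewrite drw_mulE /= ?mulr0; first exact: raddf0.
by rewrite omFd_teich oact0l addr0.
Qed.

Definition drw_complex : witt_complex Z2loc :=
  @WittComplex Z2loc (fun n => drw n : pzRingType) drw_deg
    (fun n => @drwR n) (fun n => @drwlam n) (fun n => @drwF n) (fun n => @drwV n)
    (fun n => @drwd n) drw_graded drw0E drwR_deg
    (fun n a => erefl) drwR_lam drwF_deg drwFR drwF_lam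
    drwV_deg drwVR drwVM drwV_lam drwFV drwd_deg drwdR drwdM
    drwFdV drwdd drwd_iota drwFd_teich.

(** * Initiality of the model *)

Lemma wcoef_wconst_wV1 n a i k : (k < n)%N ->
  wcoef (wconst n a * wV1 Z2loc i n) k = if k == i then a else 0.
Proof.
have g j : (j < n)%N ->
    ghost j (wconst n a * wV1 Z2loc i n) = if (i <= j)%N then a * 2 ^+ i else 0.
  move=> ltj; rewrite ghostM // ghost_wconst // ghost_wV1 //.
  by case: ifP; rewrite ?mulr0.
case: k => [|k] ltkn.
  rewrite [LHS]g // leqn0 eq_sym; case: eqP => // <-; exact: mulr1.
apply: wcoefS; rewrite (g _ ltkn) (g _ (ltnW ltkn)) (leq_eqVlt i) ltnS.
rewrite (eq_sym i); case: eqP => [<-|_] /=.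
  by rewrite ltnn add0r mulrC.
by rewrite mulr0 addr0.
Qed.

Lemma wcoef_sum_wV1 n (c : 'I_n -> Z2loc) (k : 'I_n) :
  wcoef (\sum_(i < n) wconst n (c i) * wV1 Z2loc i n) k = c k.
Proof.
rewrite (big_morph (fun x => wcoef x k) (fun x y => wcoefD x y (ltn_ord k))
  (wcoef0 (ltn_ord k))).
rewrite (bigD1 k) //= wcoef_wconst_wV1 // eqxx big1 ?addr0 // => i.
by rewrite -val_eqE eq_sym /= => /negPf nik; rewrite wcoef_wconst_wV1 // nik.
Qed.

Lemma mulrn_Zt (M : zmodType) t (x : M) (a b : Zt t) : x *+ 2 ^ t.+1 = 0 ->
  x *+ (a + b)%R = x *+ a + x *+ b.
Proof.
move=> x0; rewrite -mulrnDr /= [X in (_ %% X)%N]Zp_cast ?exp2_gt1 //.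
by rewrite [in RHS](divn_eq (a + b) (2 ^ t.+1)) mulrnDr mulnC mulrnA x0 mul0rn add0r.
Qed.

Section OmGenerators.
Variable n : nat.

Definition omdelta (i : nat) : om n := omk n (fun t => (t == i)%:R).

Lemma omdeltaE i (j : 'I_n.-1) : omdelta i j = (val j == i)%:R.
Proof. by rewrite ffunE rmorph_nat. Qed.

Lemma om_expansion (m : om n) : m = \sum_(i < n.-1) omdelta i *+ (m i).
Proof.
apply/ffunP => j.
rewrite (big_morph (fun m : om n => m j) (id1 := 0) (op1 := +%R)) /=; last first.
- exact: ffunE.
- by move=> u v; apply: ffunE.
have mn k (u : om n) : (u *+ k) j = u j *+ k.
  elim: k => [|k IHk]; first exact: ffunE.
  by rewrite !mulrS -IHk; apply: ffunE.
rewrite (bigD1 j) //= big1 => [|i nij]; rewrite mn omdeltaE.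
  by rewrite eqxx addr0 natr_Zp.
by rewrite -val_eqE eq_sym in nij; rewrite (negPf nij) mul0rn.
Qed.
End OmGenerators.

Lemma drw_dV1 i n : dV1 drw_complex i.+1 n = (0, omdelta n i).
Proof.
rewrite /dV1 V1_lam; apply: drw_eq; [by [] | apply: om_ext => t ltt].
rewrite -[LHS]/(redZ t (omlift (omd (wV1 Z2loc i.+1 n)) t)).
rewrite omlift_d // omlift_omk // -(mul1r (wV1 _ _ _)) -(rmorph1 (wconst n)).
by rewrite wcoef_wconst_wV1 ?eqSS -?ltn_predRL //; case: eqP.
Qed.

Lemma om_span n (P : om n -> Prop) : (forall i, P (omdelta n i)) -> P 0 ->
  (forall m k, P m -> P k -> P (m + k)) -> forall m, P m.
Proof.
move=> PD P0 PA m; rewrite [m]om_expansion; elim/big_rec: _ => // i k _ Pk.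
apply: (PA) => //; elim: (nat_of_ord (m i)) => // j IHj; rewrite mulrS.
exact: PA.
Qed.

Lemma drw_omD n (m k : om n) : (0, m + k) = (0, m) + (0, k) :> drw n.
Proof. by apply: drw_eq; rewrite /= ?addr0. Qed.

Lemma drw_om0 n : (0, 0) = 0 :> drw n.
Proof. by []. Qed.

Lemma drw_split n (u : drw n) : u = drwlam u.1 + (0, u.2).
Proof. by apply: drw_eq; rewrite /= ?addr0 ?add0r. Qed.

Lemma drwlam_om n x (m : om n) : drwlam x * (0, m) = (0, oact x m).
Proof. by apply: drw_eq; rewrite drw_mulE /= ?mulr0 // oact0l addr0. Qed.

Lemma drw_span n (P : drw n -> Prop) :
  (forall x, P (drwlam x)) -> (forall i, P (dV1 drw_complex i n)) ->
  (forall u v, P u -> P v -> P (u + v)) -> forall u, P u.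
Proof.
move=> Plam PD PA u; rewrite (drw_split u); apply: (PA) => //.
move: u.2; apply: om_span => [i||m k Pm Pk].
- by rewrite -drw_dV1.
- by have := Plam 0; rewrite raddf0.
by rewrite drw_omD; apply: PA.
Qed.

Lemma witt_span n (P : witt Z2loc n -> Prop) :
  (forall a i, P (wconst n a * wV1 Z2loc i n)) ->
  (forall x y, P x -> P y -> P (x + y)) -> forall x, P x.
Proof.
move=> PV PA x; rewrite [x]witt_expansion; elim/big_rec: _ => [|i y _ Py].
  by have := PV 0 0%N; rewrite rmorph0 mul0r.
exact: PA.
Qed.

Section Constants.
Variables (E : witt_complex Z2loc) (n : nat).

(** a q = p with p an integer and q invertible in Z_(2); d kills integers, so q times the derivative
    is zero. *)
Lemma d_wconst a : wc_d E n (wc_lam E n (wconst n a)) = 0.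
Proof.
have [p [q [u [aq qu]]]] := Z2loc_fraction a.
set y := wc_lam _ _ _.
have dq : wc_d E n y *+ q = 0.
  rewrite -raddfMn /= -mulr_natr -(rmorph_nat (wc_lam E n)) -(rmorph_nat (wconst n)).
  by rewrite -!rmorphM aq !rmorph_int raddfMz /= wc_d1 mul0rz.
rewrite -[LHS]mulr1 -(rmorph1 (wc_lam E n)) -(rmorph1 (wconst n)) -qu !rmorphM.
by rewrite !rmorph_nat mulrA mulr_natr dq mul0r.
Qed.

(** As 2^i dV^i(1) = 0, the scalar a acts through its residue modulo 2^i. *)
Lemma wconst_dV1 a i :
  wc_lam E n (wconst n a) * dV1 E i n = dV1 E i n *+ res2 i a.
Proof.
have /dvd2P[c Ec] := res2P i a.
rewrite -{1}(subrK (res2 i a)%:R a) Ec -natrX.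
rewrite !rmorphD !rmorphM /= !rmorph_nat mulrDl [X in _ + X]mulr_natl -mulrA.
have -> : (2 ^ i)%:R * (wc_lam E n (wconst n c) * dV1 E i n) = 0.
  by rewrite mulr_natl -mulrnAr dV1_mulrn_exp2 mulr0.
by rewrite add0r.
Qed.

End Constants.

Section Initial.
Variable E : witt_complex Z2loc.

Section Map.
Variable n : nat.

Definition drw_map (u : drw n) : E n :=
  wc_lam E n u.1 + \sum_(i < n.-1) dV1 E i.+1 n *+ (u.2 i : nat).

Fact drw_map_nmod : nmod_morphism drw_map.
Proof.
split=> [|u v]; rewrite /drw_map.
  rewrite rmorph0 add0r big1 // => i _.
  by have -> : (0 : drw n).2 i = 0 by apply: ffunE.
rewrite rmorphD addrACA -big_split /=; congr (_ + _); apply: eq_bigr => i _.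
rewrite -mulrn_Zt ?dV1_mulrn_exp2 //; congr (_ *+ _).
by congr nat_of_ord; apply: ffunE.
Qed.
HB.instance Definition _ := GRing.isNmodMorphism.Build (drw n) (E n) drw_map drw_map_nmod.

Lemma drw_mapD u v : drw_map (u + v) = drw_map u + drw_map v.
Proof. exact: raddfD. Qed.

Lemma drw_map_lam x : drw_map (drwlam x) = wc_lam E n x.
Proof.
rewrite /drw_map /= big1 ?addr0 // => i _.
by have -> : (0 : om n) i = 0 by apply: ffunE.
Qed.

Lemma drw_map_dV1 i : drw_map (dV1 drw_complex i n) = dV1 E i n.
Proof.
case: i => [|i]; first by rewrite !dV10 raddf0.
case: (ltnP i n.-1) => [lti | lei]; last first.
  by rewrite !dV1_ge ?raddf0 //; move: lei; lia.
rewrite drw_dV1 /drw_map rmorph0 add0r (bigD1 (Ordinal lti)) //=.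
rewrite omdeltaE eqxx /= modn_small ?ltnS // big1 ?addr0 // => j nj.
by rewrite omdeltaE -[val j == i]/(j == Ordinal lti) (negPf nj).
Qed.

Lemma drw_map_dlogN1_V1 i :
  drw_map (dlogN1 drw_complex n * V1 drw_complex i n) = dlogN1 E n * V1 E i n.
Proof.
rewrite !dlogN1_V1 raddf_sum; apply: eq_bigr => s _.
by rewrite raddfMn /= drw_map_dV1.
Qed.

Lemma drw_map_om_deg (m : om n) : wc_deg 1 (drw_map (0, m)).
Proof.
rewrite /drw_map rmorph0 add0r; apply: wc_deg_sum => i _.
exact/wc_degMn/dV1_deg.
Qed.

Lemma drw_map_wconst a (m : om n) :
  drw_map (drwlam (wconst n a) * (0, m)) = wc_lam E n (wconst n a) * drw_map (0, m).
Proof.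
move: m; apply: om_span => [i||m k IHm IHk].
- rewrite -drw_dV1 [X in drw_map X](wconst_dV1 drw_complex) raddfMn /=.
  by rewrite drw_map_dV1 wconst_dV1.
- by rewrite drw_om0 mulr0 raddf0 mulr0.
by rewrite drw_omD mulrDr !drw_mapD IHm IHk [RHS]mulrDr.
Qed.

(** [V1_mul_dV1] applies to the model and to E alike. *)
Lemma drw_map_V1_dV1 i j :
  drw_map (V1 drw_complex i n * dV1 drw_complex j n) = V1 E i n * dV1 E j n.
Proof.
case: i => [|i]; first by rewrite !V10 !mul1r drw_map_dV1.
case: j => [|j]; first by rewrite !dV10 !mulr0 raddf0.
by rewrite !V1_mul_dV1 // raddfD raddfMn /= drw_map_dV1 drw_map_dlogN1_V1.
Qed.

Lemma drw_map_lam_om x (m : om n) :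
  drw_map (drwlam x * (0, m)) = wc_lam E n x * drw_map (0, m).
Proof.
move: x; apply: witt_span => [a i|x y IHx IHy]; last first.
  by rewrite (raddfD (@drwlam n)) mulrDl drw_mapD IHx IHy rmorphD mulrDl.
rewrite !rmorphM /= -!mulrA.
(* V^i(1) times a form is a form, so the constant can be split off first. *)
rewrite drwlam_om drw_map_wconst -drwlam_om; congr (_ * _).
rewrite -V1_lam -[drwlam _]/(wc_lam drw_complex n _) -V1_lam.
move: m; apply: om_span => [j||m k IHm IHk].
- by rewrite -drw_dV1 drw_map_V1_dV1 drw_map_dV1.
- by rewrite drw_om0 mulr0 raddf0 mulr0.
by rewrite drw_omD mulrDr !drw_mapD IHm IHk [RHS]mulrDr.
Qed.

Lemma drw_map_om_om (m k : om n) : drw_map (0, m) * drw_map (0, k) = 0.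
Proof.
move: m; apply: om_span => [i||m m' IHm IHm'].
- move: k; apply: om_span => [j||k k' IHk IHk'].
  + by rewrite -!drw_dV1 !drw_map_dV1 dV1_mul.
  + by rewrite drw_om0 raddf0 mulr0.
  by rewrite drw_omD drw_mapD mulrDr IHk IHk' addr0.
- by rewrite drw_om0 raddf0 mul0r.
by rewrite drw_omD drw_mapD mulrDl IHm IHm' addr0.
Qed.

Fact drw_map_monoid : monoid_morphism drw_map.
Proof.
split=> [|u v].
  by have := drw_map_lam 1; rewrite !rmorph1.
have -> : u * v = drwlam (u.1 * v.1) + drwlam u.1 * (0, v.2) + drwlam v.1 * (0, u.2).
  apply: drw_eq; first by rewrite /= !mulr0 !addr0.
  by rewrite /= !oact0l !addr0 add0r.
rewrite !drw_mapD !drw_map_lam_om drw_map_lam rmorphM.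
rewrite [in RHS](drw_split u) [in RHS](drw_split v) !drw_mapD !drw_map_lam.
have foil (a b c e : E n) : (a + b) * (c + e) = a * c + a * e + (b * c + b * e).
  by rewrite mulrDl !mulrDr.
rewrite [RHS]foil drw_map_om_om addr0.
congr (_ + _); apply: wc_comm0 (drw_map_om_deg _); exact: wc_lam_deg.
Qed.
HB.instance Definition _ :=
  GRing.isMonoidMorphism.Build (drw n) (E n) drw_map drw_map_monoid.

Lemma drw_map_d u : drw_map (drwd u) = wc_d E n (drw_map u).
Proof.
move: u; apply: drw_span => [|i|u v IHu IHv].
- apply: witt_span => [a i|x y IHx IHy]; last first.
    by rewrite (raddfD (@drwlam n)) (raddfD (@drwd n)) !drw_mapD IHx IHy [RHS]raddfD.
  (* Stated for any complex in order to be used on both sides of the map. *)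
  have dW (E' : witt_complex Z2loc) :
      wc_d E' n (wc_lam E' n (wconst n a * wV1 Z2loc i n))
      = wc_lam E' n (wconst n a) * dV1 E' i n.
    rewrite rmorphM -V1_lam wc_dM0 ?d_wconst ?mul0r ?add0r //.
    exact: wc_lam_deg.
  rewrite -[drwd _]/(wc_d drw_complex n (wc_lam drw_complex n _)) dW drw_map_lam dW.
  by rewrite rmorphM /= drw_map_dV1 drw_map_lam.
- rewrite drw_map_dV1 d_dV1 -[drwd _]/(wc_d drw_complex n _) d_dV1.
  exact: raddf0.
by rewrite (raddfD (@drwd n)) !drw_mapD IHu IHv [RHS]raddfD.
Qed.

Lemma drw_map_deg i (u : drw n) : drw_deg i u -> wc_deg i (drw_map u).
Proof.
case: i => [|[|i]] du.
- rewrite (drw_split u) (du : u.2 = 0).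
  by rewrite raddfD [X in _ + X]raddf0 addr0 /= drw_map_lam; apply: wc_lam_deg.
- rewrite (drw_split u) (du : u.1 = 0) raddf0 add0r.
  exact: drw_map_om_deg.
by rewrite (du : u = 0) raddf0; apply: (gr_zero (wc_graded E n)).
Qed.

End Map.

Lemma drw_map_R n (u : drw n.+1) : drw_map (drwR u) = wc_R E n (drw_map u).
Proof.
move: u; apply: drw_span => [x|i|u v IHu IHv].
- by rewrite drwR_lam !drw_map_lam wc_lamR.
- by rewrite -[drwR _]/(wc_R drw_complex n _) !(drw_map_dV1, R_dV1).
by rewrite (raddfD (@drwR n)) !drw_mapD IHu IHv [RHS]raddfD.
Qed.

Lemma drw_map_F n (u : drw n.+1) : drw_map (drwF u) = wc_F E n (drw_map u).
Proof.
move: u; apply: drw_span => [x|[|i]|u v IHu IHv].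
- by rewrite drwF_lam !drw_map_lam wc_lamF.
- by rewrite drw_map_dV1 !dV10 !raddf0.
- rewrite -[drwF _]/(wc_F drw_complex n _) drw_map_dV1 !F_dV1S raddfD /=.
  by rewrite drw_map_dV1 drw_map_dlogN1_V1.
by rewrite (raddfD (@drwF n)) !drw_mapD IHu IHv [RHS]raddfD.
Qed.

Lemma drw_map_V n (u : drw n) : drw_map (drwV u) = wc_V E n (drw_map u).
Proof.
move: u; apply: drw_span => [x|i|u v IHu IHv].
- by rewrite drwV_lam !drw_map_lam wc_lamV.
- rewrite -[drwV _]/(wc_V drw_complex n _) drw_map_dV1 !V_dV1 raddfMn /=.
  by rewrite drw_map_dV1.
by rewrite (raddfD (@drwV n)) !drw_mapD IHu IHv [RHS]raddfD.
Qed.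

End Initial.

(** * Transport of the structure to an arbitrary initial complex *)

Section Morphisms.
Variables (A : comPzRingType) (E E' : witt_complex A).
Variable f : forall n, {rmorphism E n -> E' n}.
Hypothesis fP : witt_complex_morphism f.

Lemma wcm_V1 i n : f n (V1 E i n) = V1 E' i n.
Proof. by rewrite !V1_lam (wcm_lam fP). Qed.

Lemma wcm_dV1 i n : f n (dV1 E i n) = dV1 E' i n.
Proof. by rewrite /dV1 (wcm_d fP) wcm_V1. Qed.

Lemma wcm_comp (E'' : witt_complex A) (g : forall n, {rmorphism E' n -> E'' n}) :
  witt_complex_morphism g -> witt_complex_morphism (fun n => g n \o f n).
Proof.
move=> gP; split=> * /=.
- exact/(wcm_deg gP)/(wcm_deg fP).
- by rewrite (wcm_R fP) (wcm_R gP).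
- by rewrite (wcm_lam fP) (wcm_lam gP).
- by rewrite (wcm_d fP) (wcm_d gP).
- by rewrite (wcm_F fP) (wcm_F gP).
- by rewrite (wcm_V fP) (wcm_V gP).
Qed.

End Morphisms.

Lemma wcm_id (A : comPzRingType) (E : witt_complex A) :
  witt_complex_morphism (fun n => idfun : {rmorphism E n -> E n}).
Proof. by split. Qed.

Theorem drw_initial : is_de_rham_witt drw_complex.
Proof.
move=> E; split.
  exists (fun n => drw_map E (n := n)); split.
  - by move=> n i x; apply: drw_map_deg.
  - exact: drw_map_R.
  - exact: drw_map_lam.
  - exact: drw_map_d.
  - exact: drw_map_F.
  - exact: drw_map_V.
move=> f g fP gP n; apply: drw_span => [x|i|u v IHu IHv].
- by rewrite -[drwlam x]/(wc_lam drw_complex n x) (wcm_lam fP) (wcm_lam gP).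
- by rewrite (wcm_dV1 fP) (wcm_dV1 gP).
by rewrite !raddfD /= IHu IHv.
Qed.

Section DirectSums.
Variables (E : witt_complex Z2loc) (n : nat).

Definition V1_scale i (a : Z2loc) : E n := wc_lam E n (wconst n a * wV1 Z2loc i n).
Fact V1_scale_nmod i : nmod_morphism (V1_scale i).
Proof.
by split=> [|a b]; rewrite /V1_scale ?raddf0 ?mul0r ?raddf0 // raddfD mulrDl raddfD.
Qed.
HB.instance Definition _ i :=
  GRing.isNmodMorphism.Build Z2loc (E n) (V1_scale i) (V1_scale_nmod i).

Definition dV1_scale t (a : Zt t) : E n := dV1 E t.+1 n *+ a.
Fact dV1_scale_nmod t : nmod_morphism (@dV1_scale t).
Proof. by split=> [|a b]; rewrite /dV1_scale // mulrn_Zt // dV1_mulrn_exp2. Qed.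
HB.instance Definition _ t :=
  GRing.isNmodMorphism.Build (Zt t) (E n) (@dV1_scale t) (dV1_scale_nmod t).

End DirectSums.

Section Structure.
Variable E : witt_complex Z2loc.
Hypothesis initE : is_de_rham_witt E.

Lemma de_rham_witt_iso : exists (f : forall n, {rmorphism E n -> drw_complex n})
    (g : forall n, {rmorphism drw_complex n -> E n}),
  [/\ witt_complex_morphism f, witt_complex_morphism g & forall n, cancel (f n) (g n)].
Proof.
have [[f fP] _] := initE drw_complex; have [[g gP] _] := drw_initial E.
exists f, g; split=> // n x.
have [_ uE] := initE E.
exact: uE (wcm_comp fP gP) (wcm_id E) n x.
Qed.

Lemma drw_deg0_sum n : direct_sum_on (wc_deg (w := E) (n := n) 0)
  (fun _ : 'I_n => Z2loc) (fun=> 1) (fun i => V1 E i n).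
Proof.
have [f [g [fP gP fK]]] := de_rham_witt_iso.
exists (fun i : 'I_n => V1_scale E n i); split.
- move=> i; rewrite [LHS]/(wc_lam E n (wconst n 1 * wV1 Z2loc i n)).
  by rewrite (rmorph1 (wconst n)) mul1r V1_lam.
- by move=> i c; apply: wc_lam_deg.
move=> x dx; pose w := (f n x).1.
have Ex : x = wc_lam E n w.
  rewrite -[LHS]fK -(wcm_lam gP); congr (g n _).
  by rewrite (drw_split (f n x)) (wcm_deg fP dx : _.2 = 0) drw_om0 addr0.
exists [ffun i : 'I_n => wcoef w i]; split=> [|c Ec].
  rewrite {1}Ex {1}[w]witt_expansion raddf_sum; apply: eq_bigr => i _ /=.
  by rewrite ffunE.
(* Uniqueness is read off in the model, where [wcoef] recovers the coefficients. *)
apply/ffunP => i; rewrite ffunE /w Ec raddf_sum.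
rewrite (eq_bigr (fun i : 'I_n => drwlam (wconst n (c i) * wV1 Z2loc i n))); last first.
  by move=> j _; apply: (wcm_lam fP).
by rewrite -raddf_sum wcoef_sum_wV1.
Qed.

Lemma drw_deg1_sum n : direct_sum_on (wc_deg (w := E) (n := n.+1) 1)
  (fun i : 'I_n => 'Z_(2 ^ i.+1)) (fun=> 1) (fun i => dV1 E i.+1 n.+1).
Proof.
have [f [g [fP gP fK]]] := de_rham_witt_iso.
exists (fun i : 'I_n => dV1_scale E n.+1 (t := i)); split.
- move=> i; rewrite /= /dV1_scale /= modn_small //.
- by move=> i c; apply: wc_degMn; apply: dV1_deg.
have drwE (c : om n.+1) : (0, c) = \sum_(i < n) dV1 drw_complex i.+1 n.+1 *+ c i.
  rewrite [in LHS](om_expansion c) /=; elim/big_rec2: _ => // i u v _ <-.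
  rewrite drw_omD drw_dV1; congr (_ + _).
  by elim: (nat_of_ord (c i)) => // k IHk; rewrite !mulrS -IHk drw_omD.
move=> x dx; pose m := (f n.+1 x).2.
have Ex : x = \sum_(i < n) dV1 E i.+1 n.+1 *+ (m i).
  rewrite -[LHS]fK (drw_split (f n.+1 x)) (wcm_deg fP dx : _.1 = 0) raddf0 add0r.
  rewrite drwE raddf_sum; apply: eq_bigr => i _.
  by rewrite raddfMn /= (wcm_dV1 gP).
exists m; split=> [|c Ec]; first exact: Ex.
(* Both families are the coordinates in the model of the image of x under f. *)
suff : (0, m) = (0, c : om n.+1) :> drw n.+1 by case.
rewrite !drwE.
have fs (h : om n.+1) : f n.+1 (\sum_(i < n) dV1 E i.+1 n.+1 *+ (h i))
    = \sum_(i < n) dV1 drw_complex i.+1 n.+1 *+ h i.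
  by rewrite raddf_sum; apply: eq_bigr => i _; rewrite raddfMn /= (wcm_dV1 fP).
rewrite -!fs; congr (f n.+1 _); rewrite -Ex; exact: Ec.
Qed.

Lemma drw_deg_ge2 n i (x : E n) : (2 <= i)%N -> wc_deg i x -> x = 0.
Proof.
have [f [g [fP gP fK]]] := de_rham_witt_iso.
case: i => [|[|i]] // _ /(wcm_deg fP) fx0.
by rewrite -[LHS]fK (fx0 : f n x = 0) raddf0.
Qed.

End Structure.

(* The level is N = n.+1 >= 1.  The de Rham-Witt complex is only defined up to
   isomorphism, so the description is stated for every initial object; the first
   conjunct records that there is one.  In degree 1, the index i : 'I_n stands
   for the generator dV^(i+1)(1). *)
Theorem mainTheorem2 :
  (exists E : witt_complex Z2loc, is_de_rham_witt E) /\
  forall E : witt_complex Z2loc, is_de_rham_witt E ->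
  forall n : nat,
  [/\ direct_sum_on (wc_deg (w := E) (n := n.+1) 0)
         (fun _ : 'I_n.+1 => Z2loc) (fun=> 1)
         (fun i => V1 E i n.+1),
      direct_sum_on (wc_deg (w := E) (n := n.+1) 1)
         (fun i : 'I_n => 'Z_(2 ^ i.+1)) (fun=> 1)
         (fun i => dV1 E i.+1 n.+1)
    & forall i (x : E n.+1), (2 <= i)%N -> wc_deg i x -> x = 0]
  /\
  [/\ forall i j, (i <= j <= n)%N ->
        V1 E i n.+1 * V1 E j n.+1 = V1 E j n.+1 *+ 2 ^ i,
      forall i j, (1 <= i < j)%N -> (j <= n)%N ->
        V1 E i n.+1 * dV1 E j n.+1 =
        dV1 E j n.+1 *+ 2 ^ i
        + \sum_(j.+1 <= s < n.+1) dV1 E s n.+1 *+ 2 ^ s.-1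
    & forall i j, (1 <= j <= i)%N -> (i <= n)%N ->
        V1 E i n.+1 * dV1 E j n.+1 =
        \sum_(i.+1 <= s < n.+1) dV1 E s n.+1 *+ 2 ^ s.-1]
  /\
  (forall i, (i <= n)%N ->
     wc_V E n.+1 (V1 E i n.+1) = V1 E i.+1 n.+2 /\
     wc_V E n.+1 (dV1 E i n.+1) = dV1 E i.+1 n.+2 *+ 2)
  /\
  (forall i, (1 <= i <= n)%N ->
     wc_F E n (V1 E i n.+1) = V1 E i.-1 n *+ 2 /\
     wc_F E n (dV1 E i n.+1) =
       dV1 E i.-1 n + \sum_(i <= s < n) dV1 E s n *+ 2 ^ s.-1)
  /\
  [/\ forall i, (1 <= i <= n)%N -> wc_d E n.+1 (V1 E i n.+1) = dV1 E i n.+1,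
      wc_d E n.+1 1 = 0
    & forall i, (i <= n)%N ->
        wc_iota (V1 E i n.+1) =
        \sum_(i.+1 <= s < n.+1) dV1 E s n.+1 *+ 2 ^ s.-1]
  /\
  (forall i, (i < n)%N ->
     wc_R E n (V1 E i n.+1) = V1 E i n /\
     wc_R E n (dV1 E i n.+1) = dV1 E i n)
  /\
  wc_R E n (V1 E n n.+1) = 0 /\ wc_R E n (dV1 E n n.+1) = 0.
Proof.
split=> [|E initE n]; first by exists drw_complex; apply: drw_initial.
split; first split.
- exact: drw_deg0_sum.
- exact: drw_deg1_sum.
- by move=> i x; apply: drw_deg_ge2.
split; first split.
- by move=> i j /andP[leij _]; apply: V1_mul.
- move=> i j /andP[i0 ltij] _; rewrite V1_mul_dV1 // ?ltij ?(maxn_idPr (ltnW ltij)).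
    by rewrite dlogN1_V1.
  exact: ltn_trans ltij.
- move=> i j /andP[j0 leji] _; rewrite V1_mul_dV1 // ?(leq_trans j0) //.
  by rewrite ltnNge leji (maxn_idPl leji) dlogN1_V1 mulr0n add0r.
split; first by move=> i _; rewrite V_dV1.
split.
  by move=> [|i] // _; rewrite F_V1 F_dV1S dlogN1_V1.
split; first split=> //.
- exact: wc_d1.
- by move=> i _; rewrite wc_iotaE dlogN1_V1.
split; first by move=> i _; rewrite R_V1 R_dV1.
by rewrite R_V1 R_dV1 V1_ge // dV1_ge.
Qed.
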